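(* Let $n\ge1$. For an $n$-diagram $D$, let $D'=(D\sqcup 1_n)\circ D_B\in\mathrm{TL}_{2n}$, where $D\sqcup 1_n$ is the $2n$-diagram obtained by placing $n$ vertical links to the right of $D$, and $D_B$ is the $2n$-diagram in which vertex $i$ is joined to vertex $2n+1-i$ on the top line and likewise on the bottom line, for $1\le i\le n$ (so $D\sqcup1_n$ is stacked on top of $D_B$). Then $D\mapsto D'\otimes 1$ defines an embedding $\mathrm{TL}_n\hookrightarrow\operatorname{Ind}_{\mathrm{TL}_n\otimes\mathrm{TL}_n}^{\mathrm{TL}_{2n}}\mathbb C_{\mathrm{triv}}$, and this embedding describes the isomorphism $\Phi:\operatorname{End}_{\mathbf U}((\mathbb C^2)^{\otimes n})\to((\mathbb C^2)^{\otimes 2n})^{\mathbf U}$ of the context: for every $n$-diagram $D$, if $\rho(D)\in\operatorname{End}_{\mathbf U}((\mathbb C^2)^{\otimes n})$ denotes the action of $D$, then $$\Phi(\rho(D))=D'\cdot\big(\underbrace{v_-\otimes\cdots\otimes v_-}_{n}\otimes\underbrace{v_+\otimes\cdots\otimes v_+}_{n}\big).$$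
   Context: Let $q\in\mathbb C$ be nonzero and not a root of unity. Temperley-Lieb algebra. An $m$-diagram consists of two parallel horizontal lines (bottom and top) with $m$ vertices each, numbered from left to right, the $2m$ vertices being joined in pairs by pairwise non-crossing edges (''links'') drawn between the lines, up to homotopy. $\mathrm{TL}_m$ is the $\mathbb C$-algebra with basis the $m$-diagrams; the product $A\circ B$ is obtained by stacking $A$ on top of $B$ and replacing each closed loop by the factor $-q-q^{-1}$. It is generated by $e_1,\dots,e_{m-1}$, where $e_i$ joins vertices $i,i+1$ on the bottom line and on the top line and has vertical links elsewhere. Action. $\mathbb C^2$ has basis $v_+,v_-$. Let $\epsilon:\mathbb C^2\otimes\mathbb C^2\to\mathbb C$, $v_+\otimes v_+\mapsto 0$, $v_+\otimes v_-\mapsto -q$, $v_-\otimes v_+\mapsto 1$, $v_-\otimes v_-\mapsto 0$, and $\delta(1)=v_+\otimes v_- -q^{-1}v_-\otimes v_+$. $\mathrm{TL}_m$ acts on $(\mathbb C^2)^{\otimes m}$ by $e_i\mapsto \mathrm{id}^{\otimes(i-1)}\otimes(\delta\circ\epsilon)\otimes\mathrm{id}^{\otimes(m-i-1)}$. Induced module. $\mathrm{TL}_n\otimes\mathrm{TL}_n\subseteq\mathrm{TL}_{2n}$ is the subalgebra generated by the $e_i$, $i\ne n$; all these $e_i$ act by $0$ on $\mathbb C_{\mathrm{triv}}$; $\operatorname{Ind}_{\mathrm{TL}_n\otimes\mathrm{TL}_n}^{\mathrm{TL}_{2n}}\mathbb C_{\mathrm{triv}}=\mathrm{TL}_{2n}\otimes_{\mathrm{TL}_n\otimes\mathrm{TL}_n}\mathbb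 C_{\mathrm{triv}}$ is embedded in $(\mathbb C^2)^{\otimes2n}$ by $g\otimes1\mapsto g\cdot(v_-^{\otimes n}\otimes v_+^{\otimes n})$. Quantum group. $\mathbf U=\mathcal U_q(\mathfrak{sl}_2)$ has generators $E,F,K^{\pm1}$ with $KK^{-1}=K^{-1}K=1$, $KE=q^2EK$, $KF=q^{-2}FK$, $EF-FE=\frac{K-K^{-1}}{q-q^{-1}}$; comultiplication $\bar\Delta(K^{\pm1})=K^{\pm1}\otimes K^{\pm1}$, $\bar\Delta(E)=E\otimes1+K^{-1}\otimes E$, $\bar\Delta(F)=F\otimes K+1\otimes F$; antipode $S(K^{\pm1})=K^{\mp1}$, $S(E)=-KE$, $S(F)=-FK^{-1}$; counit $E,F\mapsto0$, $K^{\pm1}\mapsto1$. It acts on $\mathbb C^2$ by $K^{\pm1}v_+=q^{\pm1}v_+$, $K^{\pm1}v_-=q^{\mp1}v_-$, $Ev_+=0$, $Ev_-=v_+$, $Fv_+=v_-$, $Fv_-=0$, and on tensor powers via $\bar\Delta$. $X^{\mathbf U}$ denotes the vectors on which $\mathbf U$ acts through the counit. By quantum Schur-Weyl duality, $\rho:\mathrm{TL}_n\to\operatorname{End}_{\mathbf U}((\mathbb C^2)^{\otimes n})$ is an isomorphism. The isomorphism $\Phi$. Let $v^+,v^-$ be the basis of $(\mathbb C^2)^*$ dual to $v_+,v_-$, and let $\phi_3:(\mathbb C^2)^*\to\mathbb C^2$, $v^+\mapsto v_-$, $v^-\mapsto -q^{-1}v_+$. $\Phi$ is the restriction to $\mathbf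 U$-invariants of the composite $\operatorname{End}((\mathbb C^2)^{\otimes n})\cong(\mathbb C^2)^{\otimes n}\otimes((\mathbb C^2)^{\otimes n})^*\cong(\mathbb C^2)^{\otimes n}\otimes((\mathbb C^2)^* )^{\otimes n}\cong(\mathbb C^2)^{\otimes2n}$, where the first map is inverse to $w\otimes\alpha\mapsto(v\mapsto\alpha(v)w)$; the second is induced by the order-reversing identification under which $\alpha_1\otimes\cdots\otimes\alpha_n\in((\mathbb C^2)^* )^{\otimes n}$ corresponds to the functional $x_1\otimes\cdots\otimes x_n\mapsto\prod_{i=1}^n\alpha_i(x_{n+1-i})$; the third applies $\phi_3$ to each of the last $n$ components. *)

(* Defs.v *)
From HB Require Import structures.
From mathcomp Require Import all_boot all_order all_algebra.
From mathcomp Require Import all_classical all_reals.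
From mathcomp Require Import zify.
From mathcomp Require Export complex.
Set Implicit Arguments.
Unset Strict Implicit.
Unset Printing Implicit Defensive.
Import GRing.Theory.
Local Open Scope ring_scope.

Notation fmod K I := {ffun I -> K^o} (only parsing).

Section Free.
Variable K : fieldType.
Local Notation free I := (fmod K I).

Definition bas (I : finType) (i : I) : free I := [ffun j => (j == i)%:R].

(* The linear map determined by the images [f i] of the basis vectors. *)
Definition lext_fun (I : finType) (V : lmodType K) (f : I -> V) (x : free I) : V :=
  \sum_i (x i : K) *: f i.

Fact lext_fun_is_linear (I : finType) (V : lmodType K) (f : I -> V) :
  linear (lext_fun f).
Proof.
move=> a x y; rewrite /lext_fun scaler_sumr -big_split /=.
by apply: eq_bigr => i _; rewrite !ffunE scalerDl scalerA.
Qed.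
HB.instance Definition _ (I : finType) (V : lmodType K) (f : I -> V) :=
  GRing.isLinear.Build K (free I) V *:%R (lext_fun f) (lext_fun_is_linear f).

Definition lext (I : finType) (V : vectType K) (f : I -> V) : 'Hom(free I, V) :=
  linfun (lext_fun f).

Lemma lextE I V f x : @lext I V f x = \sum_i (x i : K) *: f i.
Proof. by rewrite lfunE. Qed.

Lemma lext_fun_bas (I : finType) (V : lmodType K) (f : I -> V) i :
  lext_fun f (bas i) = f i.
Proof.
rewrite /lext_fun (bigD1 i) //= big1 ?addr0 => [|j /negPf ne_ji].
  by rewrite ffunE eqxx scale1r.
by rewrite ffunE ne_ji scale0r.
Qed.

Lemma lext_bas I V f i : @lext I V f (bas i) = f i.
Proof. by rewrite lfunE /= lext_fun_bas. Qed.

Lemma bas_sum (I : finType) (x : free I) : x = \sum_i (x i : K) *: bas i.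
Proof.
apply/ffunP => j; rewrite sum_ffunE (bigD1 j) //= big1 ?addr0 => [|i ne_ij].
  by rewrite !ffunE eqxx /= [RHS]mulr1.
by rewrite !ffunE eq_sym (negPf ne_ij) [LHS]mulr0.
Qed.
End Free.

(* Vertices of an m-diagram: [inl i] on the bottom line, [inr i] on the top
   line, both numbered from left to right starting from 0. *)
Definition vertex (m : nat) : finType := ('I_m + 'I_m)%type.

(* Position on the boundary of the strip, traversed counterclockwise: the
   bottom line from left to right, then the top line from right to left. *)
Definition bpos m (p : vertex m) : nat :=
  match p with inl i => i | inr i => m + rev_ord i end.

(* Up to homotopy a diagram is a non-crossing perfect matching of its vertices,
   encoded as the involution sending a vertex to the other end of its link. *)
Definition is_diagram m (d : {ffun vertex m -> vertex m}) : bool :=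
  [&& [forall p, d p != p],
      [forall p, d (d p) == p] &
      [forall p, forall r,
         ~~ [&& bpos p < bpos r, bpos r < bpos (d p) & bpos (d p) < bpos (d r)]%N]].

Record diagram m := Diagram {
  link : {ffun vertex m -> vertex m};
  linkP : is_diagram link }.
HB.instance Definition _ m := [isSub for @link m].
HB.instance Definition _ m := [Finite of diagram m by <:].

Definition mate m (D : diagram m) (p : vertex m) : vertex m := link D p.
Coercion mate : diagram >-> Funclass.

Lemma bpos_lt m (p : vertex m) : (bpos p < m + m)%N.
Proof. by case: p => i /=; have := ltn_ord i; lia. Qed.

Lemma is_diagramP m (f : vertex m -> vertex m) :
  (forall p, f p != p) -> (forall p, f (f p) = p) ->
  (forall p r, (bpos p < bpos r)%N -> (bpos r < bpos (f p))%N ->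
     (bpos (f p) < bpos (f r))%N -> False) ->
  is_diagram (finfun f).
Proof.
move=> f1 f2 f3; apply/and3P; split.
- by apply/forallP => p; rewrite ffunE.
- by apply/forallP => p; rewrite !ffunE f2.
- apply/forallP => p; apply/forallP => r; rewrite !ffunE.
  by apply/negP => /and3P[]; apply: f3.
Qed.

Definition id_link m (p : vertex m) : vertex m :=
  match p with inl i => inr i | inr i => inl i end.

Fact id_link_proof m : is_diagram (finfun (@id_link m)).
Proof.
apply: is_diagramP => [[]|[]|[i|i] [j|j]] //=;
  have := ltn_ord i; have := ltn_ord j; lia.
Qed.
Definition id_diagram m := Diagram (id_link_proof m).

(* Indices are counted from 0: [e_ i], for [i : 'I_m.-1], is the generator
   usually written e_(i+1). *)
Fact ordl_proof m (i : 'I_m.-1) : (i < m)%N.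
Proof. by have := ltn_ord i; lia. Qed.
Fact ordr_proof m (i : 'I_m.-1) : (i.+1 < m)%N.
Proof. by have := ltn_ord i; lia. Qed.
Definition ordl m (i : 'I_m.-1) : 'I_m := Ordinal (ordl_proof i).
Definition ordr m (i : 'I_m.-1) : 'I_m := Ordinal (ordr_proof i).

Definition e_link m (i : 'I_m.-1) (p : vertex m) : vertex m :=
  match p with
  | inl k => if k == ordl i then inl (ordr i)
             else if k == ordr i then inl (ordl i) else inr k
  | inr k => if k == ordl i then inr (ordr i)
             else if k == ordr i then inr (ordl i) else inl k
  end.

Fact e_link_proof m (i : 'I_m.-1) : is_diagram (finfun (e_link i)).
Proof.
have ne : (ordr i == ordl i) = false by apply/eqP => /(congr1 val) /=; lia.
apply: is_diagramP => [[k|k]|[k|k]|p r] /=.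
1,2: case: (eqVneq k (ordl i)) => [->|_]; last case: (eqVneq k (ordr i)) => [->|_] //;
     by apply/eqP => -[] /=; lia.
1,2: by case: (eqVneq k (ordl i)) => [->|kl] /=; rewrite ?ne ?eqxx //;
     case: (eqVneq k (ordr i)) => [->|kr] /=;
     rewrite ?eqxx ?(negPf kl) ?(negPf kr).
case: p => [k|k]; case: r => [l|l] /=; rewrite -!val_eqE /=;
  do ![case: ifP => /= ?]; have := ltn_ord i; have := ltn_ord k;
  have := ltn_ord l; lia.
Qed.
Definition e_ m (i : 'I_m.-1) := Diagram (e_link_proof i).

Definition DB_link n (p : vertex (n + n)) : vertex (n + n) :=
  match p with inl k => inl (rev_ord k) | inr k => inr (rev_ord k) end.

Fact DB_link_proof n : is_diagram (finfun (@DB_link n)).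
Proof.
apply: is_diagramP => [[k|k]|[k|k]|[k|k] [l|l]] /=; rewrite ?rev_ordK //;
  try (by apply/eqP => -[/(congr1 val)] /=; have := ltn_ord k; lia);
  have := ltn_ord k; have := ltn_ord l; lia.
Qed.
Definition DB n := Diagram (DB_link_proof n).

Fact splitL m n (i : 'I_m) : fintype.split (lshift n i) = inl i.
Proof. exact: (unsplitK (inl _ i)). Qed.
Fact splitR m n (j : 'I_n) : fintype.split (rshift m j) = inr j.
Proof. exact: (unsplitK (inr _ j)). Qed.

Definition left_vertex n (p : vertex n) : vertex (n + n) :=
  match p with inl i => inl (lshift n i) | inr i => inr (lshift n i) end.

Definition add_id_link n (D : diagram n) (p : vertex (n + n)) : vertex (n + n) :=
  match p with
  | inl k => match fintype.split k with
             | inl i => left_vertex (D (inl i)) | inr j => inr (rshift n j) end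
  | inr k => match fintype.split k with
             | inl i => left_vertex (D (inr i)) | inr j => inl (rshift n j) end
  end.

Fact add_id_link_proof n (D : diagram n) : is_diagram (finfun (add_id_link D)).
Proof.
have aL p : add_id_link D (left_vertex p) = left_vertex (D p).
  by case: p => i /=; rewrite splitL.
have aB j : add_id_link D (inl (rshift n j)) = inr (rshift n j).
  by rewrite /= splitR.
have aT j : add_id_link D (inr (rshift n j)) = inl (rshift n j).
  by rewrite /= splitR.
have cases p : [\/ exists p', p = left_vertex p', exists j, p = inl (rshift n j) |
                   exists j, p = inr (rshift n j)].
  case: p => k; case: (split_ordP k) => j ->.
  - by constructor 1; exists (inl j).
  - by constructor 2; exists j.
  - by constructor 1; exists (inr j).
  - by constructor 3; exists j.
have /and3P[/forallP D1 /forallP D2 /forallP D3] := linkP D.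
have {}D1 (p : vertex n) : D p != p by apply: D1.
have {}D2 (p : vertex n) : D (D p) = p by apply/eqP/D2.
have D4 (p r : vertex n) : (bpos p < bpos r)%N -> (bpos r < bpos (D p))%N ->
    (bpos (D p) < bpos (D r))%N -> False.
  by move=> h1 h2 h3; move/forallP/(_ r)/and3P: (D3 p); apply.
have injL : injective (@left_vertex n).
  by move=> [i|i] [j|j] //= [] ij; congr (_ _); apply: val_inj.
have posL (p : vertex n) : bpos (left_vertex p) =
    if (bpos p < n)%N then bpos p else (bpos p + (n + n))%N.
  by case: p => i /=; have := ltn_ord i; case: ifP; lia.
apply: is_diagramP => p.
- by case: (cases p) => -[p' ->]; rewrite ?aL ?aB ?aT ?(inj_eq injL).
- by case: (cases p) => -[p' ->]; rewrite ?aL ?aB ?aT // D2.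
move=> r; case: (cases p) => -[p' ->]; case: (cases r) => -[r' ->];
  rewrite ?aL ?aB ?aT ?posL /=.
- move=> h1 h2 h3; have := bpos_lt p'; have := bpos_lt r'.
  have := bpos_lt (D p'); have := bpos_lt (D r'); move: h1 h2 h3.
  by do ![case: ifP] => *; apply: (@D4 p' r'); lia.
all: try have := ltn_ord r'; try have := ltn_ord p'; try have := bpos_lt p';
  try have := bpos_lt (D p'); try have := bpos_lt r';
  try have := bpos_lt (D r'); do ?[case: ifP]; lia.
Qed.

Definition add_id n (D : diagram n) : diagram (n + n) :=
  Diagram (add_id_link_proof D).

(* Three lines: [inl (inl i)] is on the bottom line of B, [inl (inr i)] on the
   middle line, where the top of B is glued to the bottom of A, and [inr i] on
   the top line of A. *)
Definition svertex (m : nat) : finType := (vertex m + 'I_m)%type.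

Definition svert_lower m (p : vertex m) : svertex m := inl p.
Definition svert_upper m (p : vertex m) : svertex m :=
  match p with inl i => inl (inr i) | inr i => inr i end.
Definition svert_outer m (p : vertex m) : svertex m :=
  match p with inl i => inl (inl i) | inr i => inr i end.

Definition stack_link m (A B : diagram m) : rel (svertex m) := fun x y =>
  [exists p, (x == svert_lower p) && (y == svert_lower (B p))]
  || [exists p, (x == svert_upper p) && (y == svert_upper (A p))].

Definition is_stack m (A B C : diagram m) : bool :=
  [forall p, forall r, (C p == r) ==
     (p != r) && connect (stack_link A B) (svert_outer p) (svert_outer r)].

(* The closed loops are the connected components which do not meet the bottom
   line of B or the top line of A. *)
Definition loops m (A B : diagram m) : nat :=
  n_comp (stack_link A B)
    [pred x | ~~ [exists p, connect (stack_link A B) (svert_outer p) x]].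

Section TemperleyLieb.
Variables (K : fieldType) (q : K).

Definition TL (m : nat) : vectType K := fmod K (diagram m).

Definition dg m (D : diagram m) : TL m := bas K D.

(* The sum has at most one term; gluing planar diagrams gives a planar diagram,
   so it is the diagram obtained by stacking A on top of B. *)
Definition stack m (A B : diagram m) : TL m :=
  (- q - q^-1) ^+ loops A B *: \sum_(C | is_stack A B C) dg C.

Definition TL_mul m (x y : TL m) : TL m :=
  lext (fun A : diagram m => lext (fun B : diagram m => stack A B) y) x.

Definition TL_one m : TL m := dg (id_diagram m).

(* [triv_acts s c]: the element s of the subalgebra generated by the [e_ i],
   [i.+1 != n], acts on the trivial module by the scalar c. *)
Inductive triv_acts n : TL (n + n) -> K -> Prop :=
| triv_e (i : 'I_(n + n).-1) : i.+1 != n -> triv_acts (dg (e_ i)) 0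
| triv_one : triv_acts (TL_one (n + n)) 1
| triv_scale a s c : triv_acts s c -> triv_acts (a *: s) (a * c)
| triv_add s t c d : triv_acts s c -> triv_acts t d -> triv_acts (s + t) (c + d)
| triv_mul s t c d : triv_acts s c -> triv_acts t d -> triv_acts (TL_mul s t) (c * d).

(* The trivial module being one-dimensional, [TL (n + n) (x) C_triv] over C is
   identified with [TL (n + n)] through [x (x) c |-> c *: x]; the tensor product
   over the subalgebra is then the quotient by the span of the elements
   [x s (x) 1 - x (x) s 1], i.e. [TL_mul x s - c *: x]. *)
Inductive ind_rel n : TL (n + n) -> Prop :=
| ind_gen x s c : triv_acts s c -> ind_rel (TL_mul x s - c *: x)
| ind_zero : ind_rel 0
| ind_lin a x y : ind_rel x -> ind_rel y -> ind_rel (a *: x + y).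

Definition ind_ker n : {pred TL (n + n)} := fun x => `[< ind_rel x >].

Fact ind_ker_submod n : submod_closed (@ind_ker n).
Proof.
split; first by apply/asboolP; exact: ind_zero.
by move=> a x y /asboolP hx /asboolP hy; apply/asboolP; exact: ind_lin.
Qed.
HB.instance Definition _ n :=
  GRing.isSubmodClosed.Build K (TL (n + n)) (@ind_ker n) (@ind_ker_submod n).

Definition Ind n := Quotient.quot (@ind_ker n).
HB.instance Definition _ n := GRing.Zmodule.on (Ind n).

Definition ind_class n (x : TL (n + n)) : Ind n := \pi_(Ind n)%qT x.

Lemma ind_class_eq n (x y : TL (n + n)) :
  ind_class x = ind_class y <-> ind_rel (x - y).
Proof.
split=> [/eqP h|h].
  have : (x - y) \in @ind_ker n by rewrite Quotient.idealrBE.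
  by move/asboolP.
by apply/eqP; rewrite -[_ == _]Quotient.idealrBE; apply/asboolP.
Qed.

Definition ind_scale n (a : K) (z : Ind n) : Ind n := ind_class (a *: repr z).

Lemma ind_classD n (x y : TL (n + n)) :
  ind_class (x + y) = ind_class x + ind_class y.
Proof. by rewrite /ind_class raddfD. Qed.
Fact ind_class_lin n (a : K) (x y : TL (n + n)) :
  ind_class (a *: x + y) = ind_scale a (ind_class x) + ind_class y.
Proof.
rewrite /ind_scale -ind_classD; apply/ind_class_eq.
rewrite opprD addrACA subrr addr0 -scalerBr -[_ *: _]addr0.
apply: ind_lin; last exact: ind_zero.
by apply/ind_class_eq; rewrite /ind_class reprK.
Qed.
Fact ind_class_scale n (a : K) (x : TL (n + n)) :
  ind_class (a *: x) = ind_scale a (ind_class x).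
Proof.
have := ind_class_lin a x 0.
by rewrite addr0 => ->; rewrite /ind_class raddf0 addr0.
Qed.
Fact ind_ex n (z : Ind n) : exists x, z = ind_class x.
Proof. by exists (repr z); rewrite /ind_class reprK. Qed.
Fact ind_scaleA n a b (z : Ind n) : ind_scale a (ind_scale b z) = ind_scale (a * b) z.
Proof. by have [x ->] := ind_ex z; rewrite -!ind_class_scale scalerA. Qed.
Fact ind_scale1 n : left_id 1 (@ind_scale n).
Proof. by move=> z; have [x ->] := ind_ex z; rewrite -ind_class_scale scale1r. Qed.
Fact ind_scaleDr n : right_distributive (@ind_scale n) +%R.
Proof.
move=> a z t; have [x ->] := ind_ex z; have [y ->] := ind_ex t.
by rewrite -ind_classD -!ind_class_scale -ind_classD scalerDr.
Qed.
Fact ind_scaleDl n (z : Ind n) : {morph (@ind_scale n)^~ z : a b / a + b}.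
Proof.
move=> a b; have [x ->] := ind_ex z.
by rewrite -!ind_class_scale scalerDl ind_classD.
Qed.
HB.instance Definition _ n := GRing.Zmodule_isLmodule.Build K (Ind n)
  (@ind_scaleA n) (@ind_scale1 n) (@ind_scaleDr n) (@ind_scaleDl n).

(* D' = (D |_| 1_n) o D_B. *)
Definition prime_of n (D : diagram n) : TL (n + n) :=
  TL_mul (dg (add_id D)) (dg (DB n)).

Definition ind_emb n : TL n -> Ind n :=
  lext_fun (fun D : diagram n => ind_class (prime_of D)).
HB.instance Definition _ n := GRing.Linear.on (@ind_emb n).

Lemma ind_emb_dg n (D : diagram n) : ind_emb (dg D) = ind_class (prime_of D).
Proof. exact: lext_fun_bas. Qed.

(* C^2 is free on [bool], [true] standing for the sign +, and its m-th tensor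
   power is free on the words of length m in the signs. *)
Definition C2 : vectType K := fmod K bool.
Definition v_ (b : bool) : C2 := bas K b.

Definition word (m : nat) : finType := {ffun 'I_m -> bool}.
Definition T (m : nat) : vectType K := fmod K (word m).
Definition vword m (s : word m) : T m := bas K s.

(* The pure tensor [x_0 (x) ... (x) x_(m-1)]. *)
Definition pure m (x : 'I_m -> C2) : T m :=
  [ffun s : word m => \prod_i (x i (s i) : K)].

(* [A_0 (x) ... (x) A_(m-1)], each A_i being given by the images of v_+, v_-. *)
Definition tens_op m (A : 'I_m -> bool -> C2) : 'End(T m) :=
  lext (fun s : word m => pure (fun i => A i (s i))).

(* [eps a b] is the value of epsilon on [v_ a (x) v_ b], and [delta a b] is the
   coefficient of [v_ a (x) v_ b] in [delta(1)]. *)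
Definition eps (a b : bool) : K :=
  match a, b with
  | true, false => - q
  | false, true => 1
  | _, _ => 0
  end.
Definition delta (a b : bool) : K :=
  match a, b with
  | true, false => 1
  | false, true => - q^-1
  | _, _ => 0
  end.

Definition e_op m (i : 'I_m.-1) : 'End(T m) :=
  lext (fun s : word m => eps (s (ordl i)) (s (ordr i)) *:
    \sum_a \sum_b delta a b *: pure (fun k =>
      if k == ordl i then v_ a else if k == ordr i then v_ b else v_ (s k))).

(* The algebra TL_m being generated by the [e_ i], there is exactly one such
   [rho]. *)
Definition TL_action m (rho : 'Hom(TL m, 'End(T m))) : Prop :=
  [/\ rho (TL_one m) = \1%VF,
      forall x y, rho (TL_mul x y) = (rho x \o rho y)%VF &
      forall i : 'I_m.-1, rho (dg (e_ i)) = e_op i].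

Definition v_minus_plus n : T (n + n) :=
  pure (fun k : 'I_(n + n) => v_ (n <= k)%N).

(* Noncommutative polynomials in the generators. U is the quotient of these by
   its defining relations; only its actions on tensor powers and its counit are
   used below, and both are determined on representatives. *)
Inductive Uq : Type :=
| UE | UF | UK | UKinv
| Uscal of K
| Uadd of Uq & Uq
| Umul of Uq & Uq.

Fixpoint counit (u : Uq) : K :=
  match u with
  | UE | UF => 0
  | UK | UKinv => 1
  | Uscal a => a
  | Uadd u v => counit u + counit v
  | Umul u v => counit u * counit v
  end.

Definition opK (b : bool) : C2 := (if b then q else q^-1) *: v_ b.
Definition opKinv (b : bool) : C2 := (if b then q^-1 else q) *: v_ b.
Definition opE (b : bool) : C2 := if b then 0 else v_ true.
Definition opF (b : bool) : C2 := if b then v_ false else 0.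

(* The generators act through the iterated comultiplication: K |-> K (x) ... (x) K,
   E |-> sum_i K^-1 (x) ... (x) K^-1 (x) E (x) 1 (x) ... (x) 1 and
   F |-> sum_i 1 (x) ... (x) 1 (x) F (x) K (x) ... (x) K, with E and F in position i. *)
Fixpoint Uact m (u : Uq) : 'End(T m) :=
  match u with
  | UE => \sum_(i < m) tens_op (fun j =>
            if (j < i)%N then opKinv else if j == i then opE else v_)
  | UF => \sum_(i < m) tens_op (fun j =>
            if (j < i)%N then v_ else if j == i then opF else opK)
  | UK => tens_op (fun _ : 'I_m => opK)
  | UKinv => tens_op (fun _ : 'I_m => opKinv)
  | Uscal a => a *: \1%VF
  | Uadd u v => Uact m u + Uact m v
  | Umul u v => (Uact m u \o Uact m v)%VF
  end.

Definition EndU m : set 'End(T m) :=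
  [set f | forall u, (Uact m u \o f)%VF = (f \o Uact m u)%VF].

Definition invU m : set (T m) :=
  [set x | forall u, Uact m u x = counit u *: x].

(* [T n] tensored with its dual, and [T n] tensored with the n-th tensor power of
   the dual of C^2, are both free on [word n * word n]: the second component of
   the index stands for an element of the basis dual to the [vword t], resp. for
   [v^(t_1) (x) ... (x) v^(t_n)]. *)
Definition TT (n : nat) : vectType K := fmod K (word n * word n)%type.

Definition end_of_tensor n : 'Hom(TT n, 'End(T n)) :=
  lext (fun p : word n * word n =>
    lext (fun s : word n => (s == p.2)%:R *: vword p.1)).

Definition tensor_of_end_fun n (f : 'End(T n)) : TT n :=
  [ffun p : word n * word n => f (vword p.2) p.1].

Fact tensor_of_end_is_linear n : linear (@tensor_of_end_fun n).
Proof.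
by move=> a f g; apply/ffunP => p; rewrite !ffunE add_lfunE scale_lfunE !ffunE.
Qed.
HB.instance Definition _ n := GRing.isLinear.Build K 'End(T n) (TT n) *:%R
  (@tensor_of_end_fun n) (@tensor_of_end_is_linear n).

Definition Phi1 n : 'Hom('End(T n), TT n) := linfun (@tensor_of_end_fun n).

Lemma Phi1K n : cancel (@Phi1 n) (@end_of_tensor n).
Proof.
move=> f.
have H (s : word n) : end_of_tensor n (Phi1 n f) (vword s) = f (vword s).
  rewrite /end_of_tensor lextE sum_lfunE.
  under eq_bigr do rewrite scale_lfunE lext_bas lfunE ffunE.
  rewrite -(pair_bigA _ (fun a b => (f (vword b) a : K) *: ((s == b)%:R *: vword a))).
  rewrite [RHS]bas_sum; apply: eq_bigr => a _ /=.
  rewrite (bigD1 s) //= eqxx scale1r big1 ?addr0 // => b /negPf.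
  by rewrite eq_sym => ->; rewrite scale0r scaler0.
apply/lfunP => x; rewrite [x]bas_sum !linear_sum; apply: eq_bigr => s _.
by rewrite !linearZ; congr (_ *: _); apply: H.
Qed.

(* The functional [v_s^*] is [x_1 (x) ... (x) x_n |-> prod_i v^(s_i)(x_i)], which
   the order-reversing identification makes correspond to
   [v^(s_n) (x) ... (x) v^(s_1)]. *)
Definition Phi2 n : 'Hom(TT n, TT n) :=
  lext (fun p : word n * word n =>
    bas K (p.1, [ffun i => p.2 (rev_ord i)] : word n)).

(* [phi3 b] is the image of the dual basis vector [v^b]. *)
Definition phi3 (b : bool) : C2 := if b then v_ false else - q^-1 *: v_ true.

Definition Phi3 n : 'Hom(TT n, T (n + n)) :=
  lext (fun p : word n * word n => pure (fun k : 'I_(n + n) =>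
    match fintype.split k with
    | inl i => v_ (p.1 i)
    | inr j => phi3 (p.2 j)
    end)).

Definition Phi n : 'Hom('End(T n), T (n + n)) := (Phi3 n \o Phi2 n \o Phi1 n)%VF.

Lemma PhiE n (f : 'End(T n)) :
  Phi n f = \sum_(s : word n) \sum_(t : word n) (f (vword t) s : K) *:
    pure (fun k : 'I_(n + n) => match fintype.split k with
                                | inl i => v_ (s i)
                                | inr j => phi3 (t (rev_ord j))
                                end).
Proof.
rewrite pair_bigA /= /Phi comp_lfunE [Phi1 n f]lfunE comp_lfunE.
rewrite [X in Phi3 n X]lextE linear_sum; apply: eq_bigr => p _.
rewrite linearZ /= /Phi3 lext_bas ffunE; congr (_ *: _).
apply/ffunP => r; rewrite !ffunE; apply: eq_bigr => k _.
by case: (fintype.split k) => j //=; rewrite ffunE.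
Qed.

(* Phi sends the operator [x |-> alpha(x) w], where [w = w_1 (x) ... (x) w_n] and
   [alpha(x_1 (x) ... (x) x_n) = prod_i alpha_i(x_(n+1-i))], to
   [w (x) phi3(alpha_1) (x) ... (x) phi3(alpha_n)]. *)
Lemma Phi_rank_one n (w a : 'I_n -> C2) :
  Phi n (lext (fun s : word n => (\prod_i (a i (s (rev_ord i)) : K)) *: pure w)) =
  pure (fun k : 'I_(n + n) =>
    match fintype.split k with inl i => w i | inr j => lext phi3 (a j) end).
Proof.
rewrite PhiE; apply/ffunP => r; rewrite sum_ffunE.
have pureE (x y : 'I_n -> C2) :
    pure (fun k : 'I_(n + n) =>
      match fintype.split k with inl i => x i | inr j => y j end) r =
    (\prod_i (x i (r (lshift n i)) : K)) * \prod_j (y j (r (rshift n j)) : K).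
  rewrite ffunE big_split_ord /=; congr (_ * _); apply: eq_bigr => i _.
    by rewrite splitL.
  by rewrite splitR.
rewrite pureE.
have -> : \prod_i (w i (r (lshift n i)) : K) =
    \sum_(s : word n) \prod_i ((w i (s i) : K) * v_ (s i) (r (lshift n i))).
  rewrite -(bigA_distr_bigA (fun i b => (w i b : K) * v_ b (r (lshift n i)))) /=.
  apply: eq_bigr => i _; rewrite {1}[w i]bas_sum sum_ffunE.
  by apply: eq_bigr => b _; rewrite ffunE.
have -> : \prod_j (lext phi3 (a j) (r (rshift n j)) : K) =
    \sum_(t : word n) \prod_j ((a j (t j) : K) * phi3 (t j) (r (rshift n j))).
  rewrite -(bigA_distr_bigA (fun j b => (a j b : K) * phi3 b (r (rshift n j)))) /=.
  apply: eq_bigr => j _; rewrite lextE sum_ffunE.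
  by apply: eq_bigr => b _; rewrite ffunE.
rewrite big_distrlr /=; apply: eq_bigr => s _; rewrite sum_ffunE.
pose rv (t : word n) : word n := [ffun i => t (rev_ord i)].
have rvK : involutive rv by move=> t; apply/ffunP => i; rewrite !ffunE rev_ordK.
rewrite [RHS](reindex_inj (inv_inj rvK)); apply: eq_bigr => t _ /=.
rewrite ffunE pureE lext_bas !ffunE !big_split /=.
rewrite /GRing.scale /= [in RHS]mulrACA; congr (_ * _).
  by rewrite mulrC; congr (_ * _); apply: eq_bigr => i _; rewrite ffunE.
by congr (_ * _); apply: eq_bigr => i _; rewrite ffunE.
Qed.

End TemperleyLieb.

(* Main.v *)
Require Import Defs.
From mathcomp Require Import all_boot all_order all_algebra.
From mathcomp Require Import all_classical all_reals complex.
From mathcomp Require Import zify ring.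
Import GRing.Theory.
Local Open Scope ring_scope.
Local Open Scope complex_scope.

(** Why the theorem is true.

    Everything rests on an explicit formula for the operator by which a diagram
    acts.  The matrix entry of [D] between two words is a product over the links
    of [D]: a cap contributes a value of epsilon, a cup a coefficient of
    delta(1), a through link a Kronecker symbol ([diagram_coef]).  Since an
    action of TL_m is prescribed only on the generators [e_ i], one has to know
    that these generate.  For this take a diagram [D] other than the identity.
    It has a cup joining two neighbouring top vertices i, i+1; by parity a second
    link crosses the vertical line between the columns i and i+1.  Cutting the
    cup and the nearest such link, and gluing the four ends left with left and
    right with right, gives a diagram [D0] of smaller horizontal width with
    [e_ i D0 = D] and no closed loop ([cup_exchange_exists], [exchange_width],
    [exchange_stack]).  The same cut is compatible with the matrix formula, by
    the zigzag identities between epsilon and delta ([exchange_op]).  Induction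
    on the width identifies the action ([TL_action_dg]), and as the generators
    commute with U, so does every diagram ([diagram_op_EndU]).

    The map Phi is, up to nonzero factors, a relabelling of matrix entries
    ([Phi_coef]), hence bijective.  It carries the action of U on tensors of
    length 2n to the adjoint action [f |-> sum u_1 f S(u_2)]: an operator acting
    on the last n factors becomes, after reversal and transposition through
    phi_3, an operator precomposed with [f] ([Phi_tens]); on the generators this
    gives [Phi_K], [Phi_Kinv], [Phi_E] and [Phi_F].  Thus the invariant vectors
    correspond to the intertwiners ([Phi_bij]).

    With the link formula, [D_B] sends v_-...- v_+...+ to the nested cups, that
    is to Phi(id), and [D |_| 1_n] acts by [D] on the first n factors; so [D']
    sends it to Phi(rho(D)) ([Phi_diagram_op]).

    Finally the vector v_-...- v_+...+ is killed by all [e_ i] other than the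
    middle one, so acting on it kills the relations of the induced module
    ([ind_rel_v_minus_plus]).  Injectivity of the embedding therefore follows
    from linear independence of the operators of the diagrams
    ([diagram_op_free]), which is a triangularity argument: evaluate at the word
    that marks which end of each link of [D] comes first on the boundary. *)

Set Implicit Arguments.
Unset Strict Implicit.
Unset Printing Implicit Defensive.

(** * Links of planar diagrams *)

Section Links.
Variable m : nat.
Implicit Types (D : diagram m) (p r : vertex m).

Lemma mate_neq D p : D p != p.
Proof. by have /and3P[/forallP h _ _] := linkP D; apply: h. Qed.

Lemma mateK D : involutive D.
Proof. by move=> p; have /and3P[_ /forallP h _] := linkP D; apply/eqP/h. Qed.

Definition noncrossing (V : Type) (pos : V -> nat) (f : V -> V) :=
  forall p r : V, (pos p < pos r)%N -> (pos r < pos (f p))%N ->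
    (pos (f p) < pos (f r))%N -> False.

Lemma mate_noncrossing D : noncrossing (@bpos m) D.
Proof.
move=> p r h1 h2 h3; have /and3P[_ _ /forallP/(_ p)/forallP/(_ r)/and3P h] := linkP D.
exact: h.
Qed.

Lemma mate_ext D D' : D =1 D' -> D = D'.
Proof. by move=> h; apply: val_inj; apply/ffunP. Qed.

Lemma bpos_inj : injective (@bpos m).
Proof.
move=> [i|i] [j|j] /=; have := ltn_ord i; have := ltn_ord j => hj hi h;
  try (congr (_ _); apply: val_inj => /=); lia.
Qed.

(** Whether two chords of a circle cross does not depend on the point at which
    the circle is cut open to number its points. *)
Lemma noncrossing_rotate (V : Type) (pos pos' : V -> nat) N k (f : V -> V) :
    (forall p : V, pos p < N)%N -> (k <= N)%N ->
    (forall p : V, pos' p = if (pos p + k < N)%N then (pos p + k)%N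
                        else (pos p + k - N)%N) ->
  involutive f -> noncrossing pos f -> noncrossing pos' f.
Proof.
move=> posN kN rot fK nc p r.
have := nc p r; have := nc r (f p); have := nc (f p) (f r); have := nc (f r) p.
rewrite !fK; have := rot p; have := rot r; have := rot (f p); have := rot (f r).
have := posN p; have := posN r; have := posN (f p); have := posN (f r).
case: ifP; case: ifP; case: ifP; case: ifP; lia.
Qed.

Definition vcol p : nat := match p with inl k => k | inr k => k end.

(** Boundary positions counted from top vertex i to the left: first the columns
    up to i (top line right to left, then bottom line), then the other columns.
    The left half plane of the vertical line after column i becomes an initial
    segment, and top vertex i+1 comes last. *)
Definition cpos (i : nat) p : nat :=
  match p with
  | inl k => (i.+1 + k)%N
  | inr k => if (k <= i)%N then (i - k)%N else (m + m + i - k)%N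
  end.

Lemma cpos_rotate i p : (i < m)%N ->
  cpos i p = if (bpos p + i.+1 < m + m)%N then (bpos p + i.+1)%N
             else (bpos p + i.+1 - (m + m))%N.
Proof. by case: p => k im /=; have := ltn_ord k; do ?case: ifP; lia. Qed.

Lemma bpos_rotate i p : (i < m)%N ->
  bpos p = if (cpos i p + (m + m - i.+1) < m + m)%N
           then (cpos i p + (m + m - i.+1))%N
           else (cpos i p + (m + m - i.+1) - (m + m))%N.
Proof. by case: p => k im /=; have := ltn_ord k; do ?case: ifP; lia. Qed.

Lemma cpos_lt i p : (i < m)%N -> (cpos i p < m + m)%N.
Proof. by case: p => k im /=; have := ltn_ord k; do ?case: ifP; lia. Qed.

Lemma cpos_col i p : (i < m)%N -> (cpos i p < i.+1 + i.+1)%N = (vcol p <= i)%N.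
Proof. by case: p => k im /=; have := ltn_ord k; do ?case: ifP; lia. Qed.

Lemma cpos_inj i : (i < m)%N -> injective (cpos i).
Proof.
by move=> im p r h; apply: bpos_inj; rewrite (bpos_rotate p im) h -bpos_rotate.
Qed.

Definition opens D p := (bpos p < bpos (D p))%N.

Lemma opens_mate D p : opens D (D p) = ~~ opens D p.
Proof.
rewrite /opens mateK; have : bpos p != bpos (D p).
  by apply/eqP => /bpos_inj e; have := mate_neq D p; rewrite -e eqxx.
lia.
Qed.

(** The involution pairs the vertices that open their link with those that
    close it. *)
Lemma even_closed D (S : {set vertex m}) :
  (forall p, p \in S -> D p \in S) -> ~~ odd #|S|.
Proof.
move=> clS; pose O := [set p in S | opens D p].
have -> : S = O :|: [set D p | p in O].
  apply/setP => p; rewrite !inE; apply/idP/orP => [pS|[/andP[]//|/imsetP[r]]].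
    have [op|op] := boolP (opens D p); [left; rewrite pS //|right].
    apply/imsetP; exists (D p); last by rewrite mateK.
    by rewrite inE clS //= opens_mate op.
  by rewrite inE => /andP[rS _] ->; apply: clS.
rewrite cardsU disjoint_setI0 ?cards0 ?subn0.
  by rewrite card_imset ?addnn ?odd_double //; apply: inv_inj; apply: mateK.
apply/pred0P => p /=; rewrite !inE; apply/negP => /andP[/andP[_ op] /imsetP[r]].
by rewrite inE => /andP[_ or] e; move: op; rewrite e opens_mate or.
Qed.

(** The columns up to i hold an even number of vertices, and those linked among
    themselves are even in number too. *)
Lemma even_crossings D (i : nat) :
  ~~ odd #|[set p | (vcol p <= i)%N & (i < vcol (D p))%N]|.
Proof.
set X := [set p | _]; pose I := [set p | (vcol p <= i)%N & (vcol (D p) <= i)%N].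
pose A := [set p : vertex m | (vcol p <= i)%N].
have eA : ~~ odd #|A|.
  by rewrite cardsE -sum1_card big_sumType /= addnn odd_double.
have eI : ~~ odd #|I|.
  by apply: (even_closed (D := D)) => p; rewrite !inE mateK andbC.
have XE : X = A :\: I.
  by apply/setP => p; rewrite !inE; case: (vcol p <= i)%N => //=; lia.
have IA : I \subset A by apply/fintype.subsetP => p; rewrite !inE => /andP[].
rewrite XE cardsDS //; move: (subset_leq_card IA); lia.
Qed.

(** A crossing link other than that of [a] exists by parity; the one whose left
    end comes first after top vertex i shields all vertices before it from the
    right half. *)
Lemma nearest_crossing D (i : nat) a :
  (i < m)%N -> (vcol a <= i)%N -> (i < vcol (D a))%N ->
  exists x, [/\ x != a, (vcol x <= i)%N, (i < vcol (D x))%N &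
    forall p, p != a -> (cpos i p < cpos i x)%N -> (vcol (D p) <= i)%N].
Proof.
move=> im ai Dai; pose X := [set p | (vcol p <= i)%N & (i < vcol (D p))%N].
have [x0 x0X] : exists x, x \in X :\ a.
  apply/set0Pn; apply/eqP => e; have := even_crossings D i.
  by rewrite -/X (cardsD1 a) e cards0 inE ai Dai.
case: (@arg_minnP _ x0 [pred p | p \in X :\ a] (cpos i) x0X) => x /=.
  rewrite in_setD1 inE => /and3P[xa xi Dxi] xmin.
exists x; split=> // p pa px; rewrite leqNgt; apply/negP => Dpi.
have : p \in X :\ a.
  rewrite !inE pa Dpi andbT /= -cpos_col //.
  by move: xi; rewrite -(cpos_col _ im); lia.
by move/xmin; rewrite leqNgt px.
Qed.

(** Without top cups, the links from top to bottom are increasing because they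
    do not cross, and an increasing self-map of 'I_m is the identity. *)
Lemma all_through_id D : (forall k l, D (inr k) != inr l) -> D = id_diagram m.
Proof.
move=> thr.
have thr' k : {l | D (inr k) = inl l}.
  by case e: (D (inr k)) => [l|l]; [exists l | have := thr k l; rewrite e eqxx].
pose f k := sval (thr' k).
have fE k : D (inr k) = inl (f k) by rewrite /f; case: (thr' k).
have finj : injective f.
  by move=> k l e; have [] : (inr k : vertex m) = inr l
     by rewrite -[LHS](mateK D) -[RHS](mateK D) !fE e.
have fmono (k l : 'I_m) : (k < l)%N -> (f k < f l)%N.
  move=> kl; rewrite ltn_neqAle; apply/andP; split.
    by apply/eqP => /val_inj/finj e; move: kl; rewrite e ltnn.
  rewrite leqNgt; apply/negP => lk.
  have := @mate_noncrossing D (inl (f l)) (inl (f k)).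
  rewrite -!fE !mateK /= !fE /=; have := ltn_ord k; have := ltn_ord l.
  have := ltn_ord (f k); have := ltn_ord (f l); lia.
have fle c : forall k : 'I_m, (k <= c -> k <= f k)%N.
  elim: c => [|c IH] k kc; first lia.
  case: (ltnP k 1) => [|k1]; first by lia.
  have km : (k.-1 < m)%N by have := ltn_ord k; lia.
  have := IH (Ordinal km); have := fmono (Ordinal km) k => /=; lia.
have fge c : forall k : 'I_m, (m - k <= c -> f k <= k)%N.
  elim: c => [|c IH] k kc; first by have := ltn_ord k; lia.
  case: (ltnP k.+1 m) => [km|]; last by have := ltn_ord (f k); lia.
  have := IH (Ordinal km); have := fmono k (Ordinal km) => /=; lia.
have fid k : f k = k.
  by apply/val_inj/eqP; rewrite eqn_leq (fge _ _ (leqnn _)) (fle _ _ (leqnn _)).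
apply: mate_ext => -[k|k]; rewrite /mate /= ffunE /= -/(mate D _).
  by rewrite -[in LHS](fid k) -fE mateK.
by rewrite fE fid.
Qed.

(** A shortest top cup has nothing under it, so its ends are neighbours. *)
Lemma top_cup D : D != id_diagram m ->
  exists i : 'I_m.-1, D (inr (ordl i)) = inr (ordr i).
Proof.
move=> Did.
pose P c := [exists k : 'I_m, exists l : 'I_m, (D (inr k) == inr l) && (l == k + c :> nat)%N].
have exP : exists c, P c.
  have [h|] := boolP [forall k, forall l, D (inr k) != inr l].
    case/eqP: Did; apply: all_through_id => k l.
    by move/forallP/(_ k)/forallP: h; apply.
  rewrite negb_forall => /existsP[k]; rewrite negb_forall => /existsP[l].
  rewrite negbK => /eqP kl.
  case: (leqP k l) => h.
    by exists (l - k)%N; apply/existsP; exists k; apply/existsP; exists l; rewrite kl eqxx /=; lia.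
  exists (k - l)%N; apply/existsP; exists l; apply/existsP; exists k.
  by rewrite -kl mateK eqxx /=; lia.
case: (ex_minnP exP) => c /existsP[k /existsP[l /andP[/eqP kl /eqP lc]]] cmin.
have c0 : c != 0%N.
  apply/eqP => c0; have := mate_neq D (inr k); rewrite kl => /eqP; apply.
  by congr inr; apply: val_inj; rewrite /= lc c0 addn0.
have [c1|c1] := eqVneq c 1%N.
  have km : (k < m.-1)%N by have := ltn_ord l; lia.
  exists (Ordinal km); have -> : ordl (Ordinal km) = k by apply: val_inj.
  by rewrite kl; congr inr; apply: val_inj => /=; lia.
have km : (k.+1 < m)%N by have := ltn_ord l; lia.
pose k1 := Ordinal km; have := @mate_noncrossing D (inr l) (inr k1).
have := @mate_noncrossing D (D (inr k1)) (inr l).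
have Dl : D (inr l) = inr k by rewrite -kl mateK.
rewrite mateK Dl; have := mate_neq D (inr k1).
case e: (D (inr k1)) => [j|j] /=.
  have := ltn_ord l; have := ltn_ord j; lia.
have nk : j != k.
  apply/eqP => jk; move: e; rewrite jk -Dl => /(congr1 D).
  by rewrite !mateK => -[/(congr1 val)] /=; lia.
have nl : j != l.
  apply/eqP => jk; move: e; rewrite jk -kl => /(congr1 D).
  by rewrite !mateK => -[/(congr1 val)] /=; lia.
move=> jk1 h1 h2.
have jk1' : (j : nat) != k.+1.
  by apply/eqP => jj; case/eqP: jk1; congr inr; apply: val_inj.
have {jk1}jk : (k.+1 < j)%N && (j < l)%N.
  move: nk nl h1 h2; rewrite -!val_eqE /=; have := ltn_ord l; have := ltn_ord j; lia.
have : P (j - k.+1)%N.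
  apply/existsP; exists k1; apply/existsP; exists j; rewrite e eqxx /=; lia.
by move/cmin; lia.
Qed.

(** Cut the links a-b and x-y and glue a to x and b to y. *)
Definition reconnect D a b x y p : vertex m :=
  if p == a then x else if p == x then a
  else if p == b then y else if p == y then b else D p.

(** [D0] is a candidate for the second factor in [D = e_ i D0]: composing with
    [e_ i] restores the cup (i, i+1) and joins [x] to its old mate.  That [x]
    lies on the left of the line after column i and its mate on the right is
    what makes the width drop, and spares any sign or power of q in the matrix
    entries. *)
Definition cup_exchange (i : 'I_m.-1) x D D0 : Prop :=
  [/\ D (inr (ordl i)) = inr (ordr i), x != inr (ordl i),
      (vcol x <= i)%N, (i < vcol (D x))%N &
      D0 =1 reconnect D (inr (ordl i)) (inr (ordr i)) x (D x)].

(** Seen from top vertex i, the four ends come in the order a, x, y, b with a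
    first and b last; by the choice of x the other vertices before x are linked
    among themselves, and likewise those between x and y.  So the new links a-x
    and y-b cross nothing. *)
Lemma cup_exchange_exists D (i : 'I_m.-1) :
  D (inr (ordl i)) = inr (ordr i) -> exists x, exists D0, cup_exchange i x D D0.
Proof.
set a : vertex m := inr (ordl i); set b : vertex m := inr (ordr i) => Da.
have im : (i < m)%N := ltn_ord (ordl i); have im1 : (i.+1 < m)%N := ltn_ord (ordr i).
have Dai : (i < vcol (D a))%N by rewrite Da.
have ai : (vcol a <= i)%N by [].
have [x [xa xi Dxi xmin]] := nearest_crossing im ai Dai.
set y := D x in Dxi *.
pose f := reconnect D a b x y.
have Db : D b = a by rewrite -Da mateK.
have Dy : D y = x by rewrite mateK.
have ab : a != b by rewrite -Da eq_sym mate_neq.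
have xy : x != y by rewrite eq_sym mate_neq.
have xb : x != b by apply: contraTneq xi => ->; rewrite /= ltnn.
have ya : y != a by apply: contraTneq Dxi => ->; rewrite /= ltnn.
have yb : y != b by apply: contraNneq xa => e; rewrite -Dy e Db.
pose simps := (eqxx, negPf ab, negPf xy, negPf xb, negPf ya, negPf yb, negPf xa,
  eq_sym a b, eq_sym x y, eq_sym x b, eq_sym y a, eq_sym y b, eq_sym x a).
have fa : f a = x by rewrite /f /reconnect !simps.
have fx : f x = a by rewrite /f /reconnect !simps.
have fb : f b = y.
  by rewrite /f /reconnect eq_sym (negPf ab) eq_sym (negPf xb) eqxx.
have fy : f y = b.
  by rewrite /f /reconnect (negPf ya) eq_sym (negPf xy) (negPf yb) eqxx.
(* Only the four vertices a, b, x, y change their mates. *)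
pose four := [:: a; b; x; y].
have fD p : p \notin four -> f p = D p.
  by rewrite !inE !negb_or /f /reconnect => /and4P[/negPf-> /negPf-> /negPf-> /negPf->].
have D4 p : p \notin four -> D p \notin four.
  rewrite !inE !(inv_eq (mateK D)) Da Db Dy -/y.
  by rewrite !negb_or => /and4P[-> -> -> ->].
have four_ind (Q : vertex m -> Prop) :
    Q a -> Q b -> Q x -> Q y -> (forall p, p \notin four -> Q p) -> forall p, Q p.
  move=> Qa Qb Qx Qy Qo p; have [|/Qo//] := boolP (p \in four).
  by rewrite !inE => /or4P[] /eqP->.
have fK : involutive f.
  apply: four_ind => [||||p p4]; rewrite ?fa ?fb ?fx ?fy //.
  by rewrite (fD p) // fD ?D4 // mateK.
have fN p : f p != p.
  move: p; apply: four_ind => [||||p p4]; rewrite ?fa ?fb ?fx ?fy ?(fD p) ?mate_neq //.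
  - by rewrite eq_sym.
  - by rewrite eq_sym.
have ncD : noncrossing (cpos i) D.
  apply: (@noncrossing_rotate _ (@bpos m) _ (m + m) i.+1).
  - exact: bpos_lt.
  - lia.
  - by move=> p; apply: cpos_rotate.
  - exact: mateK.
  - exact: mate_noncrossing.
have cn p r : p != r -> cpos i p != cpos i r.
  by move=> pr; apply/eqP => /(cpos_inj im) e; rewrite e eqxx in pr.
have ca : cpos i a = 0%N by rewrite /= leqnn subnn.
have cb : cpos i b = (m + m).-1 by rewrite /= ltnn; lia.
have cx : (cpos i x < i.+1 + i.+1)%N by rewrite cpos_col.
have cy : (i.+1 + i.+1 <= cpos i y)%N by rewrite leqNgt cpos_col // -ltnNge.
(* No link leaves the vertices before x, apart from those of a and x. *)
have near p : p \notin four -> (cpos i p < cpos i x)%N = (cpos i (D p) < cpos i x)%N.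
  have half r : r \notin four -> (cpos i r < cpos i x)%N -> (cpos i (D r) < cpos i x)%N.
    move=> r4 rx; have r4' := D4 _ r4; move: r4 r4'.
    rewrite !inE !negb_or => /and4P[ra rb nrx ry] /and4P[_ _ Drx _].
    have := xmin r ra rx; rewrite -(cpos_col _ im) => h.
    move: (cn _ _ Drx) (@ncD r x rx) h cy; rewrite -/y; clear; lia.
  by move=> p4; apply/idP/idP => h; [|rewrite -[p](mateK D)]; apply: half; rewrite ?D4.
(* Nor does any link of another vertex pass over y. *)
have far p : p \notin four -> (cpos i p < cpos i y)%N = (cpos i (D p) < cpos i y)%N.
  have half r : r \notin four -> (cpos i r < cpos i y)%N -> (cpos i (D r) < cpos i y)%N.
    move=> r4 ry; have [|rx] := boolP (cpos i r < cpos i x)%N.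
      by rewrite near //; move: cx cy; clear; lia.
    have r4' := D4 _ r4; move: (r4) r4'.
    rewrite !inE !negb_or => /and4P[_ _ nrx _] /and4P[_ _ _ Dry].
    move: (cn _ _ Dry) (cn _ _ nrx) (@ncD x r) ry rx; rewrite -/y; clear; lia.
  by move=> p4; apply/idP/idP => h; [|rewrite -[p](mateK D)]; apply: half; rewrite ?D4.
have off p : p \notin four -> [&& cpos i p != 0%N, cpos i p != (m + m).-1,
    cpos i p != cpos i x & cpos i p != cpos i y].
  rewrite !inE !negb_or => /and4P[pa pb px py].
  by rewrite -ca -cb !cn.
have ord4 : [&& 0 < cpos i x, cpos i x < cpos i y & cpos i y < (m + m).-1]%N.
  move: (cn _ _ xa) (cn _ _ yb) (cpos_lt y im) cx cy; rewrite ca cb; clear; lia.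
have ncf : noncrossing (cpos i) f.
  move=> p r; have := cpos_lt (f r) im; move: p r.
  apply: (four_ind) => [||||p p4]; apply: (four_ind) => [||||r r4];
    rewrite ?fa ?fb ?fx ?fy ?fD // ?fD // ?ca ?cb.
  all: try by move: ord4; clear; lia.
  - move: (near r r4) (far r r4) (off r r4) (off _ (D4 r r4)) ord4; clear; lia.
  - move: (near p p4) (far p p4) (off p p4) (off _ (D4 p p4)) ord4; clear; lia.
  - by move=> _; apply: ncD.
have ncb : noncrossing (@bpos m) f.
  apply: (@noncrossing_rotate _ (cpos i) _ (m + m) (m + m - i.+1)) => //.
  - by move=> p; apply: cpos_lt.
  - lia.
  - by move=> p; apply: bpos_rotate.
exists x, (Diagram (is_diagramP fN fK ncb)); split=> // p.
by rewrite /mate /= ffunE.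
Qed.

End Links.

(** * Factoring a generator out of a diagram *)

Lemma big_four (R : Type) (idx : R) (op : Monoid.com_law idx) (I : finType)
    (a b x y : I) (F : I -> R) : uniq [:: a; b; x; y] ->
  \big[op/idx]_p F p =
  op (F a) (op (F b) (op (F x) (op (F y)
    (\big[op/idx]_(p | p \notin [:: a; b; x; y]) F p)))).
Proof.
rewrite /= !inE !negb_or -!andbA => /and5P[ab ax ay bx /and3P[b_y xy _]].
rewrite (bigD1 a) //= (bigD1 b) 1?eq_sym //=.
rewrite (bigD1 x) /=; last by rewrite ![x == _]eq_sym ax bx.
rewrite (bigD1 y) /=; last by rewrite ![y == _]eq_sym ay b_y xy.
by do 4![congr (op _ _)]; apply: eq_bigl => p; rewrite !inE !negb_or !andbA.
Qed.

Section Exchange.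
Variables (m : nat) (i : 'I_m.-1) (x : vertex m) (D D0 : diagram m).
Hypothesis ex : cup_exchange i x D D0.
Let a : vertex m := inr (ordl i).
Let b : vertex m := inr (ordr i).
Let y := D x.

Lemma exchange_uniq : uniq [:: a; b; x; y].
Proof.
have [Da xa xi yi _] := ex; rewrite -/a -/b in Da xa; rewrite /= !inE !negb_or -!andbA.
have ab : a != b by rewrite -Da eq_sym mate_neq.
have xy : x != y by rewrite eq_sym mate_neq.
have xb : x != b by apply: contraTneq xi => ->; rewrite /= ltnn.
have ya : y != a by apply: contraTneq yi => e; rewrite -/y e /= ltnn.
have yb : y != b by apply: contraNneq xa => e; rewrite -[x](mateK D) -/y e -Da mateK.
by rewrite ab xy ![_ == x]eq_sym ![_ == y]eq_sym xb ya yb xa.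
Qed.

Lemma exchange_matesD : [/\ D a = b, D b = a, D x = y & D y = x].
Proof. by have [Da _ _ _ _] := ex; rewrite -/a -/b in Da; split; rewrite ?mateK // -Da mateK. Qed.

Lemma exchange_mates : [/\ D0 a = x, D0 b = y, D0 x = a & D0 y = b].
Proof.
have [_ _ _ _ D0E] := ex; have := exchange_uniq.
rewrite /= !inE !negb_or -!andbA => /and5P[ab ax ay bx /and3P[b_y xy _]].
rewrite !D0E /reconnect -/a -/b -/y !eqxx [b == a]eq_sym [x == a]eq_sym.
rewrite [y == a]eq_sym [y == b]eq_sym [y == x]eq_sym.
by rewrite (negPf ab) (negPf ax) (negPf bx) (negPf ay) (negPf b_y) (negPf xy); split.
Qed.

Lemma exchange_other p : p \notin [:: a; b; x; y] -> D0 p = D p.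
Proof.
have [_ _ _ _ D0E] := ex.
by rewrite D0E !inE !negb_or /reconnect -/y => /and4P[/negPf-> /negPf-> /negPf-> /negPf->].
Qed.

End Exchange.

(** Truncated subtraction counts each link from its right end only, so this is
    the total horizontal extent of the links. *)
Definition width m (D : diagram m) : nat := \sum_p (vcol p - vcol (D p))%N.

(** The two links of extent 1 and y - x are traded for links of extent i - x and
    y - (i+1), so the total drops by 2. *)
Lemma exchange_width m (i : 'I_m.-1) x (D D0 : diagram m) :
  cup_exchange i x D D0 -> (width D0 < width D)%N.
Proof.
move=> ex; have [_ _ xi yi _] := ex.
rewrite /width !(big_four _ _ (exchange_uniq ex)) /=.
have [-> -> -> ->] := exchange_mates ex; have [-> -> _ ->] := exchange_matesD ex.
rewrite (eq_bigr (fun p => vcol p - vcol (D p))%N) => [|p /(exchange_other ex)-> //].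
by move=> /=; lia.
Qed.

(** The induction form of the fact that the generators [e_ i] generate. *)
Lemma diagram_ind_exchange m (P : diagram m -> Prop) :
    P (id_diagram m) ->
    (forall i x D D0, cup_exchange i x D D0 -> P D0 -> P D) ->
  forall D, P D.
Proof.
move=> Pid Pex D; have [n] := ubnP (width D); elim: n D => // n IH D Dn.
have [->//|/top_cup[i Di]] := eqVneq D (id_diagram m).
have [x [D0 ex]] := cup_exchange_exists Di.
by apply: (Pex _ _ _ _ ex); apply: IH; have := exchange_width ex; lia.
Qed.

Section Stack.
Variables (m : nat) (A B : diagram m).

Lemma stack_link_sym : symmetric (stack_link A B).
Proof.
have half u v : stack_link A B u v -> stack_link A B v u.
  case/orP=> /existsP[p /andP[/eqP-> /eqP->]]; apply/orP; [left|right].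
    by apply/existsP; exists (B p); rewrite mateK !eqxx.
  by apply/existsP; exists (A p); rewrite mateK !eqxx.
by move=> u v; apply/idP/idP; apply: half.
Qed.

Lemma connect_lower p :
  connect (stack_link A B) (svert_lower p) (svert_lower (B p)).
Proof. by apply/connect1/orP; left; apply/existsP; exists p; rewrite !eqxx. Qed.

Lemma connect_upper p :
  connect (stack_link A B) (svert_upper p) (svert_upper (A p)).
Proof. by apply/connect1/orP; right; apply/existsP; exists p; rewrite !eqxx. Qed.

(** A certificate for a product of diagrams without closed loops: label every
    vertex of the stack by an outer vertex of its component.  Along a
    link the label may only stay or pass to its mate in [C], so a component meets
    at most one pair of mates; the last two hypotheses say that it contains the
    whole pair. *)
Lemma stack_labelling (K : fieldType) (q : K) (C : diagram m)
    (lab : svertex m -> vertex m) :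
    (forall p, lab (svert_outer p) = p) ->
    (forall p, lab (svert_lower (B p)) \in
       [:: lab (svert_lower p); C (lab (svert_lower p))]) ->
    (forall p, lab (svert_upper (A p)) \in
       [:: lab (svert_upper p); C (lab (svert_upper p))]) ->
    (forall u, connect (stack_link A B) (svert_outer (lab u)) u) ->
    (forall p, connect (stack_link A B) (svert_outer p) (svert_outer (C p))) ->
  stack q A B = dg K C.
Proof.
move=> lab_outer labB labA con conC.
have loops0 : loops A B = 0%N.
  rewrite /loops /n_comp_mem; apply: eq_card0 => u; rewrite !inE.
  apply/negbTE; rewrite negb_and negbK; apply/orP; right.
  by apply/existsP; exists (lab u).
have lab_link u v : stack_link A B u v -> lab v \in [:: lab u; C (lab u)].
  by case/orP=> /existsP[p /andP[/eqP-> /eqP->]].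
have lab_con p r : connect (stack_link A B) (svert_outer p) (svert_outer r) ->
    r \in [:: p; C p].
  (* The component of p meets only labels p and C p. *)
pose cl := [pred u | lab u \in [:: p; C p]].
  have clo : closed (stack_link A B) cl.
    move=> u v /lab_link; rewrite !inE; case/orP => /eqP->//.
    by rewrite (inv_eq (mateK C)) (inj_eq (inv_inj (mateK C))) orbC.
  by move/(closed_connect clo); rewrite !inE !lab_outer eqxx /= => /esym.
have stackC C' : is_stack A B C' = (C' == C).
  apply/forallP/eqP => [h|-> p].
    apply: mate_ext => p; apply/eqP; have /forallP/(_ (C p))/eqP-> := h p.
    by rewrite conC andbT eq_sym mate_neq.
  apply/forallP => r; apply/eqP; apply/eqP/andP => [<-|[pr /lab_con]].
    by rewrite conC eq_sym mate_neq.
  by rewrite !inE eq_sym (negPf pr) eq_sym => /eqP.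
rewrite /stack loops0 expr0 scale1r (eq_bigl _ _ stackC) big_pred1_eq //.
Qed.
End Stack.

(** In the stack, middle vertex k continues to top vertex k, except that the
    middle vertices i and i+1, joined by [e_ i], connect x with its old mate. *)
Lemma exchange_stack (K : fieldType) (q : K) m (i : 'I_m.-1) x (D D0 : diagram m) :
  cup_exchange i x D D0 -> stack q (e_ i) D0 = dg K D.
Proof.
move=> ex; set a : vertex m := inr (ordl i); set b : vertex m := inr (ordr i).
pose y := D x.
have [D0a D0b D0x D0y] := exchange_mates ex.
have [Da Db _ Dy] := exchange_matesD ex.
have lr : (ordr i == ordl i) = false by apply/eqP => /(congr1 val) /=; lia.
have := exchange_uniq ex; rewrite -/a -/b -/y.
rewrite /= !inE !negb_or -!andbA => /and5P[ab ax ay bx /and3P[b_y xy _]].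
have eE p : e_ i p = e_link i p by rewrite /mate ffunE.
(* The outer vertex reached from each vertex of the stack. *)
pose lab (u : svertex m) : vertex m :=
  match u with
  | inl (inl k) => inl k
  | inl (inr k) => if k == ordl i then x else if k == ordr i then y else inr k
  | inr k => inr k
  end.
pose con := connect (stack_link (e_ i) D0).
have con_sym u v : con u v = con v u.
  by apply: sym_connect_sym; apply: stack_link_sym.
have lab_lower p : p != a -> p != b -> lab (svert_lower p) = p.
  case: p => k //= ka kb; have [kE|_] := eqVneq k (ordl i).
    by rewrite kE /a eqxx in ka.
  by have [kE|//] := eqVneq k (ordr i); rewrite kE /b eqxx in kb.
have con_lower p : p != a -> p != b -> con (svert_outer p) (svert_lower p).
  case: p => k /= ka kb; first exact: connect0.
  have := connect_upper (e_ i) D0 (inr k); rewrite eE /=.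
  have [kE|_] := eqVneq k (ordl i); first by rewrite kE /a eqxx in ka.
  by have [kE|//] := eqVneq k (ordr i); rewrite kE /b eqxx in kb.
have con_x : con (svert_outer x) (inl a).
  rewrite /a -D0x; apply: (connect_trans (con_lower _ _ _)); rewrite 1?eq_sym //.
  exact: connect_lower.
have con_y : con (svert_outer y) (inl b).
  rewrite /b -D0y; apply: (connect_trans (con_lower _ _ _)); rewrite 1?eq_sym //.
  exact: connect_lower.
have con_ab : con (inl a) (inl b).
  have := connect_upper (e_ i) D0 (inl (ordl i)).
  by rewrite eE /= eqxx.
have con_top : con (inr (ordl i)) (inr (ordr i)).
  have := connect_upper (e_ i) D0 (inr (ordl i)).
  by rewrite eE /= eqxx.
have other p : p \notin [:: a; b; x; y] -> D p \notin [:: a; b; x; y].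
  rewrite !inE !(inv_eq (mateK D)) -/a -/b in Da Db Dy *; rewrite Da Db Dy -/y.
  by rewrite !negb_or => /and4P[-> -> -> ->].
apply: (@stack_labelling _ _ _ _ _ _ lab).
- by case.
- move=> p; have [|p4] := boolP (p \in [:: a; b; x; y]).
    rewrite !inE => /or4P[] /eqP->; rewrite ?D0a ?D0b ?D0x ?D0y.
    + by rewrite (lab_lower x) 1?eq_sym //= eqxx eqxx.
    + by rewrite (lab_lower y) 1?eq_sym //= lr eqxx eqxx.
    + by rewrite (lab_lower x) 1?eq_sym //= eqxx eqxx.
    + by rewrite (lab_lower y) 1?eq_sym //= lr eqxx eqxx.
  have := other p p4; move: (p4); rewrite (exchange_other ex) //.
  rewrite !inE !negb_or => /and4P[pa pb _ _] /and4P[Dpa Dpb _ _].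
  by rewrite !lab_lower // eqxx orbT.
- move=> [k|k]; rewrite eE /=; case: (eqVneq k (ordl i)) => [kE|kl] /=;
    rewrite ?kE ?lr ?eqxx.
  + by rewrite !inE eqxx orbT.
  + case: (eqVneq k (ordr i)) => [kE|kr] /=; rewrite ?kE ?lr ?eqxx.
      by rewrite !inE Dy eqxx orbT.
    by rewrite !inE eqxx.
  + by rewrite !inE Da eqxx orbT.
  + case: (eqVneq k (ordr i)) => [kE|kr] /=; rewrite ?kE ?lr ?eqxx ?(negPf kl) ?(negPf kr).
      by rewrite !inE Db eqxx orbT.
    by rewrite !inE eqxx.
- move=> [[k|k]|k] /=; rewrite ?connect0 //.
  case: (eqVneq k (ordl i)) => [->//|kl]; case: (eqVneq k (ordr i)) => [->//|kr].
  exact: (con_lower (inr k)).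
- move=> p; have [|p4] := boolP (p \in [:: a; b; x; y]).
    have con_xy : con (svert_outer x) (svert_outer y).
      apply: connect_trans con_x (connect_trans con_ab _).
      by rewrite -/con con_sym.
    rewrite !inE => /or4P[] /eqP->; rewrite ?Da ?Db ?Dy //.
    + by rewrite -/con con_sym.
    + by rewrite -/con con_sym.
  have := other p p4; move: (p4).
  rewrite !inE !negb_or => /and4P[pa pb _ _] /and4P[Dpa Dpb _ _].
  apply: connect_trans (con_lower p pa pb) _.
  apply: connect_trans (connect_lower _ _ p) _.
  by rewrite (exchange_other ex) // -/con con_sym; apply: con_lower.
Qed.

(** * The operator of a diagram *)

Definition upd m (i : 'I_m.-1) (s : word m) (a b : bool) : word m :=
  [ffun k => if k == ordl i then a else if k == ordr i then b else s k].

Lemma ordr_neq m (i : 'I_m.-1) : (ordr i == ordl i) = false.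
Proof. by apply/eqP => /(congr1 val) /=; lia. Qed.

Lemma upd_sym m (i : 'I_m.-1) (s t : word m) :
  (s == upd i t (s (ordl i)) (s (ordr i))) = (t == upd i s (t (ordl i)) (t (ordr i))).
Proof.
apply/eqP/eqP => /ffunP e; apply/ffunP => k; have := e k; rewrite !ffunE;
  by case: eqP => [->//|_]; case: eqP => [->|].
Qed.

Section Operators.
Variables (K : fieldType) (q : K).
Hypothesis q_neq0 : q != 0.

Lemma bas_ext (I : finType) (V : vectType K) (f g : 'Hom(fmod K I, V)) :
  (forall i, f (bas K i) = g (bas K i)) -> f = g.
Proof.
move=> fg; apply/lfunP => x; rewrite [x]bas_sum !linear_sum.
by apply: eq_bigr => i _; rewrite !linearZ; congr (_ *: _); apply: fg.
Qed.

Lemma word_eq_prod m (s t : word m) :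
  \prod_k (s k == t k)%:R = (s == t)%:R :> K.
Proof.
have [->|ne] := eqVneq s t; first by rewrite big1 // => k _; rewrite eqxx.
have [k sk] : exists k, s k != t k.
  apply/existsP; rewrite -negb_forall; apply: contra ne => /forallP h.
  by apply/eqP/ffunP => k; apply/eqP/h.
by rewrite (bigD1 k) //= (negPf sk) mul0r.
Qed.

Lemma pure_v m (w : word m) : pure (fun k => v_ K (w k)) = vword K w.
Proof.
apply/ffunP => s; rewrite !ffunE -word_eq_prod.
by apply: eq_bigr => k _; rewrite ffunE.
Qed.

(** The factor of the link from [p] to [r] in the matrix entry at output [s] and
    input [w].  A product over all vertices meets each link twice; the factor is
    attached to the left end of a cup or cap and to the bottom end of a through
    link, the other end contributing 1. *)
Definition link_weight m (s w : word m) (p r : vertex m) : K :=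
  match p, r with
  | inl k, inl l => if (k < l)%N then eps q (w k) (w l) else 1
  | inl k, inr l => (w k == s l)%:R
  | inr k, inr l => if (k < l)%N then delta q (s k) (s l) else 1
  | inr _, inl _ => 1
  end.

Definition diagram_coef m (D : diagram m) (s w : word m) : K :=
  \prod_p link_weight s w p (D p).

Definition diagram_op m (D : diagram m) : 'End(T K m) :=
  lext (fun w : word m => [ffun s => diagram_coef D s w] : T K m).

Lemma diagram_op_id m : diagram_op (id_diagram m) = \1%VF.
Proof.
apply: bas_ext => w; rewrite lext_bas lfunE /=; apply/ffunP => s.
rewrite !ffunE /diagram_coef big_sumType /=.
rewrite [X in _ * X]big1 ?mulr1 => [|k _]; last by rewrite /mate /= ffunE.
rewrite eq_sym -word_eq_prod; apply: eq_bigr => k _.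
by rewrite /mate /= ffunE.
Qed.

(** Replacing a double sum over the letters at sites i, i+1 by the only term
    that can agree with a given word. *)
Lemma sum_upd m (i : 'I_m.-1) (s t : word m) (g : bool -> bool -> K) :
  \sum_a \sum_b g a b * (t == upd i s a b)%:R =
  g (t (ordl i)) (t (ordr i)) * (t == upd i s (t (ordl i)) (t (ordr i)))%:R.
Proof.
rewrite pair_bigA /= (bigD1 (t (ordl i), t (ordr i))) //= big1 ?addr0 //.
move=> [a b] /= ne; case: eqP => [e|]; last by rewrite mulr0.
by case/eqP: ne; rewrite e !ffunE ordr_neq !eqxx.
Qed.

Lemma e_op_vword m (i : 'I_m.-1) (w : word m) :
  e_op q i (vword K w) = eps q (w (ordl i)) (w (ordr i)) *:
    \sum_a \sum_b delta q a b *: vword K (upd i w a b).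
Proof.
rewrite /e_op lext_bas; congr (_ *: _); apply: eq_bigr => a _.
apply: eq_bigr => b _; congr (_ *: _); rewrite -pure_v; congr pure.
by apply/funext => k; rewrite ffunE; case: ifP => // _; case: ifP.
Qed.

Lemma e_opE m (i : 'I_m.-1) (x : T K m) (s : word m) :
  (e_op q i x s : K) = delta q (s (ordl i)) (s (ordr i)) *
    \sum_a \sum_b eps q a b * (x (upd i s a b) : K).
Proof.
transitivity (\sum_t (x t : K) * (eps q (t (ordl i)) (t (ordr i)) *
    (delta q (s (ordl i)) (s (ordr i)) * (s == upd i t (s (ordl i)) (s (ordr i)))%:R))).
  rewrite {1}[x]bas_sum linear_sum sum_ffunE; apply: eq_bigr => t _.
  rewrite linearZ /= ffunE -[bas K t]/(vword K t) e_op_vword.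
  rewrite [LHS]/GRing.scale /= ffunE; congr (_ * _).
  rewrite [LHS]/GRing.scale /=; congr (_ * _).
  rewrite -(sum_upd _ _ _ (delta q)) sum_ffunE; apply: eq_bigr => a _.
  rewrite sum_ffunE; apply: eq_bigr => b _.
  by rewrite !ffunE.
rewrite mulr_sumr.
under [RHS]eq_bigr do rewrite mulr_sumr.
transitivity (\sum_a \sum_b \sum_t delta q (s (ordl i)) (s (ordr i)) *
    (eps q a b * ((x t : K) * (t == upd i s a b)%:R))).
  rewrite pair_bigA /= exchange_big /=; apply: eq_bigr => t _.
  rewrite -(pair_bigA _ (fun a b => delta q (s (ordl i)) (s (ordr i)) *
    (eps q a b * ((x t : K) * (t == upd i s a b)%:R)))) /=.
  have h := sum_upd i s t (fun a b => delta q (s (ordl i)) (s (ordr i)) * (x t : K) * eps q a b).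
  rewrite upd_sym.
  transitivity (delta q (s (ordl i)) (s (ordr i)) * (x t : K) *
    eps q (t (ordl i)) (t (ordr i)) * (t == upd i s (t (ordl i)) (t (ordr i)))%:R).
    by ring.
  rewrite -h; apply: eq_bigr => a _; apply: eq_bigr => b _; ring.
apply: eq_bigr => a _; apply: eq_bigr => b _.
rewrite (bigD1 (upd i s a b)) //= eqxx mulr1 big1 ?addr0 // => t /negPf ->.
by rewrite !mulr0.
Qed.

(** The links other than those at the four exchanged ends contribute the same
    factor on both sides.  What remains is, according to the lines on which [x]
    and its mate lie, one of the four ways of contracting epsilon with a
    delta or a Kronecker symbol on each side; the case of two top ends is the
    zigzag identity. *)
Lemma exchange_op m (i : 'I_m.-1) x (D D0 : diagram m) :
  cup_exchange i x D D0 -> (e_op q i \o diagram_op D0)%VF = diagram_op D.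
Proof.
move=> ex; apply: bas_ext => w; rewrite comp_lfunE !lext_bas.
apply/ffunP => s; rewrite e_opE ffunE.
under eq_bigr do under eq_bigr do rewrite ffunE.
rewrite /diagram_coef (big_four _ _ (exchange_uniq ex)) /=.
under eq_bigr do under eq_bigr do rewrite (big_four _ _ (exchange_uniq ex)) /=.
have [-> -> -> ->] := exchange_mates ex; have [-> -> _ ->] := exchange_matesD ex.
set r := (X in _ = _ * (_ * (_ * (_ * X)))).
have rE a b : \prod_(p | p \notin [:: inr (ordl i); inr (ordr i); x; D x])
    link_weight (upd i s a b) w p (D0 p) = r.
  apply: eq_bigr => p p4; rewrite (exchange_other ex) //.
  have : D p \notin [:: inr (ordl i); inr (ordr i); x; D x].
    move: p4; have [Da Db Dx Dy] := exchange_matesD ex.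
    rewrite !inE !(inv_eq (mateK D)) Da Db Dy.
    by rewrite !negb_or => /and4P[-> -> -> ->].
  move: p4; rewrite !inE !negb_or => /and4P[pa pb _ _] /and4P[Dpa Dpb _ _].
  have updE k : inr k != inr (ordl i) :> vertex m ->
      inr k != inr (ordr i) :> vertex m -> upd i s a b k = s k.
    move=> ka kb; rewrite ffunE; have [kE|_] := eqVneq k (ordl i).
      by rewrite kE eqxx in ka.
    by have [kE|//] := eqVneq k (ordr i); rewrite kE eqxx in kb.
  by case: p pa pb Dpa Dpb => k; case: (D _) => l //= *; rewrite ?updE.
under eq_bigr do under eq_bigr do rewrite rE.
have := ex => -[_ xa xi yi _].
have := exchange_uniq ex; rewrite /= !inE !negb_or -!andbA.
move=> /and5P[_ _ ya xb /and3P[yb _ _]].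
have il : (i < i.+1)%N := leqnn _.
have li : (i.+1 < i)%N = false by lia.
clearbody r; clear rE; rewrite !ltnSn li.
clear ex; move: (D x) yi ya yb => y yi ya yb.
have updl a b : upd i s a b (ordl i) = a by rewrite ffunE eqxx.
have updr a b : upd i s a b (ordr i) = b by rewrite ffunE ordr_neq eqxx.
have updo a b (l : 'I_m) : (l : nat) != i -> (l : nat) != i.+1 -> upd i s a b l = s l.
  by move=> li1 li2; rewrite ffunE -!val_eqE /= (negPf li1) (negPf li2).
have top_neq (k l : 'I_m) : inr k != inr l :> vertex m -> (k : nat) != l.
  by apply: contraNneq => /val_inj ->.
case: x xa xi xb => j /= xa xi xb; case: y yi ya yb => k /= yi ya yb;
  under eq_bigr do under eq_bigr do rewrite ?updl ?updr.
- have -> : (j < k)%N by lia.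
  have -> : (k < j)%N = false by lia.
  by rewrite !big_bool /=; case: (w j); case: (w k) => /=; field.
- have ik : (i.+1 < k)%N by have /= := top_neq _ _ yb; lia.
  have ki : (k < i.+1)%N = false by lia.
  have kE a b : upd i s a b k = s k by apply: updo; lia.
  under eq_bigr do under eq_bigr do rewrite ik ki kE.
  by rewrite !big_bool /=; case: (w j); case: (s k) => /=; field.
- have ji : (j < i)%N by have /= := top_neq _ _ xa; lia.
  have ij : (i < j)%N = false by lia.
  have jE a b : upd i s a b j = s j by apply: updo; lia.
  under eq_bigr do under eq_bigr do rewrite ji ij jE.
  by rewrite !big_bool /=; case: (w k); case: (s j) => /=; field.
- have ik : (i.+1 < k)%N by have /= := top_neq _ _ yb; lia.
  have ki : (k < i.+1)%N = false by lia.
  have ji : (j < i)%N by have /= := top_neq _ _ xa; lia.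
  have ij : (i < j)%N = false by lia.
  have -> : (j < k)%N by lia.
  have -> : (k < j)%N = false by lia.
  have jE a b : upd i s a b j = s j by apply: updo; lia.
  have kE a b : upd i s a b k = s k by apply: updo; lia.
  under eq_bigr do under eq_bigr do rewrite ji ij ik ki jE kE.
  by rewrite !big_bool /=; case: (s k); case: (s j) => /=; field.
Qed.
End Operators.

(** * Linear independence of the diagram operators *)

Section Independence.
Variable m : nat.
Implicit Types (D : diagram m) (p : vertex m).

(** A balanced parenthesis word has one planar matching.  Treat the openers from
    the last one backwards: if the mate c of p in [E] came before its mate in
    [E'], then in [E'] the vertex c would close an opener after p, already known
    to be matched with c in [E] as well. *)
Lemma opens_inj D D' : opens D =1 opens D' -> D = D'.
Proof.
have half E E' p : opens E =1 opens E' -> opens E p ->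
    (forall r, opens E r -> (bpos p < bpos r)%N -> E r = E' r) ->
    (bpos (E p) < bpos (E' p))%N -> False.
  move=> op o IH h; pose t := E' (E p).
  have t_op : opens E t by rewrite op opens_mate -op opens_mate o.
  have pt : bpos p != bpos t.
    apply/eqP => /bpos_inj e; move: h; rewrite [in E' p]e /t mateK ltnn //.
  have Et : E' t = E p by rewrite mateK.
  have tp : (bpos p < bpos t)%N.
    have := @mate_noncrossing _ E' t p; rewrite Et; move: o h pt; rewrite /opens.
    by move: (bpos _) (bpos _) (bpos _) (bpos _) => *; lia.
  have e := IH _ t_op tp; move: pt; rewrite -[p](mateK E) -Et -e mateK eqxx //.
move=> op; apply: mate_ext => p.
suff openers c r : opens D r -> (m + m - bpos r < c)%N -> D r = D' r.
  have [o|o] := boolP (opens D p); first exact: (openers _ _ o (ltnSn _)).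
  have o' : opens D (D p) by rewrite opens_mate o.
  by have := openers _ _ o' (ltnSn _); rewrite mateK => e; rewrite {2}e mateK.
elim: c r => // c IH r o rc.
have later t : opens D t -> (bpos r < bpos t)%N -> D t = D' t.
  by move=> ot rt; apply: IH => //; have := bpos_lt t; lia.
apply: bpos_inj; case: (ltngtP (bpos (D r)) (bpos (D' r))) => // h; exfalso; first exact: (half D D' r).
have op' : opens D' =1 opens D by move=> t; rewrite op.
apply: (half D' D r op' _ _ h); first by rewrite -op.
by move=> t ot rt; rewrite later // op.
Qed.

(** The sum over the links of the position of the earlier end. *)
Definition opener_sum D : nat := \sum_p opens D p * bpos p.

(** Compatibility says that the openers of [D] select one end of each link of
    [D'].  The sum of the selected positions is least when the earlier ends are
    selected, and then [D'] has the same openers as [D]. *)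
Lemma opener_sum_le D D' : (forall p, opens D (D' p) = ~~ opens D p) ->
  (opener_sum D' <= opener_sum D ?= iff (D' == D))%N.
Proof.
move=> compat.
have split_sum (S : vertex m -> bool) : (\sum_p S p * bpos p =
    \sum_(p | opens D' p) (S p * bpos p + S (D' p) * bpos (D' p)))%N.
  rewrite (bigID (opens D')) /= big_split /=; congr addn.
  rewrite (reindex_inj (inv_inj (mateK D'))) /=; apply: eq_bigl => p.
  by rewrite opens_mate negbK.
have key p : opens D' p -> (opens D' p * bpos p + opens D' (D' p) * bpos (D' p)
   <= opens D p * bpos p + opens D (D' p) * bpos (D' p) ?= iff opens D p)%N.
  rewrite compat opens_mate => o; rewrite o; move: o; rewrite /opens.
  by case: (opens D p) => /= o; split; lia.
rewrite /opener_sum !split_sum.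
have [le eq] := leqif_sum key; split=> //; rewrite eq.
apply/forallP/eqP => [h|-> p]; last by apply/implyP.
apply: opens_inj => p.
have op r : opens D' r -> opens D r by move=> o; have /implyP/(_ o) := h r.
apply/idP/idP => [|o]; first exact: op.
apply: contraLR (o) => no; have := op (D' p).
by rewrite opens_mate no compat => /(_ isT).
Qed.
End Independence.

Section IndependenceOp.
Variables (K : fieldType) (q : K).
Hypothesis q_neq0 : q != 0.

(** The pair of words marking the openers of [D].  The top word is complemented
    because the ends of a through link carry equal letters, while one end opens
    and the other closes. *)
Definition bottom_word m (D : diagram m) : word m := [ffun k => opens D (inl k)].
Definition top_word m (D : diagram m) : word m := [ffun k => ~~ opens D (inr k)].

Lemma diagram_coef_compat m (D D' : diagram m) :
  diagram_coef q D' (top_word D) (bottom_word D) != 0 ->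
  forall p, opens D (D' p) = ~~ opens D p.
Proof.
move=> /prodf_neq0 h p; have := h p isT; have := h (D' p) isT.
rewrite mateK; have := mate_neq D' p.
case: p => k; case: (D' _) => l /=; rewrite !ffunE.
- case: (ltngtP k l) => [_ _ _|_ _|/val_inj -> /eqP//];
    by case: (opens D _); case: (opens D _); rewrite //= eqxx.
- by case: (opens D _); case: (opens D _); rewrite //= eqxx.
- by case: (opens D _); case: (opens D _); rewrite //= eqxx.
- case: (ltngtP k l) => [_ _ _|_ _|/val_inj -> /eqP//];
    by case: (opens D _); case: (opens D _); rewrite //= eqxx.
Qed.

Lemma diagram_coef_diag m (D : diagram m) :
  diagram_coef q D (top_word D) (bottom_word D) != 0.
Proof.
apply/prodf_neq0 => p _; have := opens_mate D p.
case: p => k; case e: (D _) => [l|l] /= o; rewrite ?ffunE ?o ?oner_neq0 //.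
- case: ifP => _; rewrite ?oner_neq0 //.
  by case: (opens D _); rewrite /= ?oppr_eq0 ?oner_neq0.
- by rewrite negbK eqxx oner_neq0.
- case: ifP => _; rewrite ?oner_neq0 //.
  by case: (opens D _); rewrite /= ?oppr_eq0 ?invr_eq0 ?oner_neq0.
Qed.

(** Among the diagrams with nonzero coefficient take one with least opener sum
    and read off the matrix entry at its opener words: by minimality no other
    diagram contributes. *)
Lemma diagram_op_free m (z : TL K m) :
  \sum_D (z D : K) *: diagram_op q D = 0 -> z = 0.
Proof.
move=> z0; apply/eqP; apply: contraT => nz.
have [D1 zD1] : exists D, z D != 0.
  apply/existsP; rewrite -negb_forall; apply: contra nz => /forallP h.
  by apply/eqP/ffunP => D; rewrite ffunE; apply/eqP/h.
case: (@arg_minnP _ D1 [pred D | z D != 0] (@opener_sum m) zD1) => D /= zD minD.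
have := congr1 (fun f : 'End(T K m) => f (vword K (bottom_word D)) (top_word D)) z0.
rewrite zero_lfunE sum_lfunE sum_ffunE ffunE (bigD1 D) //= big1 => [|D' ne].
  rewrite addr0 scale_lfunE ffunE lext_bas ffunE => /eqP.
  by rewrite mulf_eq0 (negPf zD) (negPf (diagram_coef_diag D)).
rewrite scale_lfunE ffunE lext_bas ffunE; have [->|nz'] := eqVneq (z D') 0.
  exact: mul0r.
have [->|/diagram_coef_compat/opener_sum_le [le eq]] :=
  eqVneq (diagram_coef q D' (top_word D) (bottom_word D)) 0; first exact: mulr0.
by move: ne; rewrite -eq eqn_leq le minD.
Qed.

End IndependenceOp.

(** * The generators commute with the quantum group *)

Section Tens.
Variables (K : fieldType) (q : K).
Hypothesis q_neq0 : q != 0.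

Lemma tens_op_vword m (A : 'I_m -> bool -> C2 K) (w : word m) :
  tens_op A (vword K w) = pure (fun k => A k (w k)).
Proof. exact: lext_bas. Qed.

Lemma tens_opE m (A : 'I_m -> bool -> C2 K) (x : T K m) (s : word m) :
  (tens_op A x s : K) = \sum_w (x w : K) * \prod_k (A k (w k) (s k) : K).
Proof.
rewrite /tens_op lextE sum_ffunE; apply: eq_bigr => w _.
by rewrite !ffunE.
Qed.

Lemma tens_op1 m : tens_op (fun _ : 'I_m => v_ K) = \1%VF.
Proof. by apply: bas_ext => w; rewrite tens_op_vword lfunE /= pure_v. Qed.

Lemma tens_op_comp m (A B : 'I_m -> bool -> C2 K) :
  (tens_op A \o tens_op B)%VF = tens_op (fun k b => lext (A k) (B k b)).
Proof.
apply: bas_ext => w; rewrite comp_lfunE !tens_op_vword; apply/ffunP => s.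
rewrite [LHS]tens_opE [RHS]ffunE.
transitivity (\sum_(t : word m) \prod_k ((B k (w k) (t k) : K) * A k (t k) (s k))).
  by apply: eq_bigr => t _; rewrite ffunE -big_split.
rewrite -(bigA_distr_bigA (fun k b => (B k (w k) b : K) * A k b (s k))) /=.
apply: eq_bigr => k _; rewrite lextE sum_ffunE; apply: eq_bigr => b _.
by rewrite ffunE.
Qed.

Lemma tens_op_scale m (A A' : 'I_m -> bool -> C2 K) (j : 'I_m) (c : K) :
    (forall k b, A k b = if k == j then c *: A' k b else A' k b) ->
  tens_op A = c *: tens_op A'.
Proof.
move=> AE; apply: bas_ext => w; rewrite scale_lfunE !tens_op_vword.
apply/ffunP => s; rewrite !ffunE (bigD1 j) //= [in RHS](bigD1 j) //=.
rewrite AE eqxx ffunE; apply: (etrans _ (esym (mulrA c _ _))); congr (_ * _).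
by apply: eq_bigr => k /negPf kj; rewrite AE kj.
Qed.

(** The matrix entries, on two neighbouring sites, of delta epsilon composed with
    [A (x) B], and in [site_cup] of the composition in the other order. *)
Definition site_cap (A B : bool -> C2 K) (a b c d : bool) : K :=
  delta q c d * \sum_a' \sum_b' eps q a' b' * ((A a a' : K) * (B b b' : K)).
Definition site_cup (A B : bool -> C2 K) (a b c d : bool) : K :=
  eps q a b * \sum_a' \sum_b' delta q a' b' * ((A a' c : K) * (B b' d : K)).

Definition off_sites m (i : 'I_m.-1) (A : 'I_m -> bool -> C2 K) (s w : word m) : K :=
  \prod_(k | (k != ordl i) && (k != ordr i)) (A k (w k) (s k) : K).

Lemma big_sites m (i : 'I_m.-1) (F : 'I_m -> K) :
  \prod_k F k = F (ordl i) * F (ordr i) *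
    \prod_(k | (k != ordl i) && (k != ordr i)) F k.
Proof.
rewrite (bigD1 (ordl i)) //= (bigD1 (ordr i)) /=; last by rewrite ordr_neq.
by rewrite mulrA.
Qed.

Lemma cap_coef m (i : 'I_m.-1) A (s w : word m) :
  (e_op q i (tens_op A (vword K w)) s : K) =
  site_cap (A (ordl i)) (A (ordr i)) (w (ordl i)) (w (ordr i)) (s (ordl i)) (s (ordr i))
    * off_sites i A s w.
Proof.
rewrite e_opE tens_op_vword /site_cap -mulrA; congr (_ * _); rewrite mulr_suml.
apply: eq_bigr => a _; rewrite mulr_suml; apply: eq_bigr => b _.
rewrite ffunE (big_sites i) !ffunE !eqxx ordr_neq !mulrA; congr (_ * _).
by apply: eq_bigr => k /andP[/negPf kl /negPf kr]; rewrite ffunE kl kr.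
Qed.

Lemma cup_coef m (i : 'I_m.-1) A (s w : word m) :
  (tens_op A (e_op q i (vword K w)) s : K) =
  site_cup (A (ordl i)) (A (ordr i)) (w (ordl i)) (w (ordr i)) (s (ordl i)) (s (ordr i))
    * off_sites i A s w.
Proof.
rewrite e_op_vword linearZ /= ffunE [LHS]/GRing.scale /= /site_cup -mulrA.
congr (_ * _); rewrite linear_sum sum_ffunE mulr_suml; apply: eq_bigr => a _.
rewrite linear_sum sum_ffunE mulr_suml; apply: eq_bigr => b _.
rewrite linearZ /= tens_op_vword !ffunE [LHS]/GRing.scale /= -mulrA; congr (_ * _).
rewrite (big_sites i) !ffunE !eqxx ordr_neq; congr (_ * _).
by apply: eq_bigr => k /andP[/negPf kl /negPf kr]; rewrite ffunE kl kr.
Qed.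

Lemma e_op_tens_comm m (i : 'I_m.-1) A :
    site_cap (A (ordl i)) (A (ordr i)) = site_cup (A (ordl i)) (A (ordr i)) ->
  (e_op q i \o tens_op A)%VF = (tens_op A \o e_op q i)%VF.
Proof.
move=> h; apply: bas_ext => w; rewrite !comp_lfunE; apply/ffunP => s.
by rewrite [LHS]cap_coef [RHS]cup_coef h.
Qed.

(** The shape of the action of E and F: the summands attached to sites away from
    i, i+1 commute with [e_ i] one by one, while the two summands attached to i
    and i+1 do so only together. *)
Lemma e_op_sum_comm m (i : 'I_m.-1) (A : 'I_m -> 'I_m -> bool -> C2 K) :
    (forall j, j != ordl i -> j != ordr i ->
      site_cap (A j (ordl i)) (A j (ordr i)) = site_cup (A j (ordl i)) (A j (ordr i))) ->
    (forall a b c d,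
      site_cap (A (ordl i) (ordl i)) (A (ordl i) (ordr i)) a b c d +
      site_cap (A (ordr i) (ordl i)) (A (ordr i) (ordr i)) a b c d =
      site_cup (A (ordl i) (ordl i)) (A (ordl i) (ordr i)) a b c d +
      site_cup (A (ordr i) (ordl i)) (A (ordr i) (ordr i)) a b c d) ->
    (forall k, k != ordl i -> k != ordr i -> A (ordl i) k = A (ordr i) k) ->
  (e_op q i \o \sum_j tens_op (A j))%VF = (\sum_j tens_op (A j) \o e_op q i)%VF.
Proof.
move=> far near off; have lr : ordr i != ordl i by rewrite ordr_neq.
rewrite (bigD1 (ordl i)) //= (bigD1 (ordr i)) //= addrA.
rewrite comp_lfunDr [RHS]comp_lfunDl; congr (_ + _); last first.
  apply/lfunP => x; rewrite !comp_lfunE !sum_lfunE linear_sum.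
  apply: eq_bigr => j /andP[jl jr].
  have := congr1 (fun f : 'End(T K m) => f x) (e_op_tens_comm (far j jl jr)).
  by rewrite !comp_lfunE.
apply: bas_ext => w; rewrite !(comp_lfunE, add_lfunE) linearD /=; apply/ffunP => s.
rewrite [LHS]ffunE [RHS]ffunE !cap_coef !cup_coef.
have -> : off_sites i (A (ordr i)) s w = off_sites i (A (ordl i)) s w.
  by apply: eq_bigr => k /andP[kl kr]; rewrite off.
by rewrite -[LHS]mulrDl near -[RHS]mulrDl.
Qed.

Ltac check_sites :=
  rewrite /site_cap /site_cup !big_bool /opK /opKinv /opE /opF !ffunE /=;
  rewrite /GRing.scale /=; field.

(** On two sites, epsilon and delta(1) are killed by the coproducts of E and F
    and fixed by those of K and its inverse. *)
Lemma e_op_Uact m (i : 'I_m.-1) u : (Uact q m u \o e_op q i)%VF = (e_op q i \o Uact q m u)%VF.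
Proof.
have vv : site_cap (v_ K) (v_ K) = site_cup (v_ K) (v_ K).
  by do 4!apply/funext => -[]; check_sites.
have KK : site_cap (opK q) (opK q) = site_cup (opK q) (opK q).
  by do 4!apply/funext => -[]; check_sites.
have KV : site_cap (opKinv q) (opKinv q) = site_cup (opKinv q) (opKinv q).
  by do 4!apply/funext => -[]; check_sites.
have lE (j : 'I_m) : j != ordl i -> j != ordr i ->
    (j < i)%N = (j < i.+1)%N /\ (i < j)%N = (i.+1 < j)%N.
  by rewrite -!val_eqE /=; split; lia.
have lr : (ordl i == ordr i) = false by rewrite eq_sym ordr_neq.
have rl := ordr_neq i.
elim: u => [||||a|u IHu v IHv|u IHu v IHv] /=.
- rewrite -e_op_sum_comm // => [j jl jr|a b c d|k kl kr] /=.
  + rewrite ![_ == j]eq_sym (negPf jl) (negPf jr); have [_ <-] := lE j jl jr.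
    by case: ifP.
  + rewrite !ltnn !eqxx lr rl ltnSn [(i.+1 < i)%N]ltnNge leqnSn /=.
    by case: a; case: b; case: c; case: d; check_sites.
  + by have [-> _] := lE k kl kr; rewrite (negPf kl) (negPf kr).
- rewrite -e_op_sum_comm // => [j jl jr|a b c d|k kl kr] /=.
  + rewrite ![_ == j]eq_sym (negPf jl) (negPf jr); have [_ <-] := lE j jl jr.
    by case: ifP.
  + rewrite !ltnn !eqxx lr rl ltnSn [(i.+1 < i)%N]ltnNge leqnSn /=.
    by case: a; case: b; case: c; case: d; check_sites.
  + by have [-> _] := lE k kl kr; rewrite (negPf kl) (negPf kr).
- by rewrite e_op_tens_comm.
- by rewrite e_op_tens_comm.
- by rewrite -comp_lfunZl -comp_lfunZr comp_lfun1l comp_lfun1r.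
- by rewrite comp_lfunDl comp_lfunDr IHu IHv.
- by rewrite -comp_lfunA IHv !comp_lfunA IHu.
Qed.

End Tens.

(** * The isomorphism Phi *)

(** Since phi_3 exchanges the two letters and the dual factors come in reverse
    order, a word of length 2n encodes the entry of a matrix whose row is its left
    half and whose column is its right half reversed and complemented. *)
Definition lword n (r : word (n + n)) : word n := [ffun k => r (lshift n k)].
Definition rword n (r : word (n + n)) : word n := [ffun k => ~~ r (rshift n (rev_ord k))].
Definition jword n (s t : word n) : word (n + n) :=
  [ffun k => match fintype.split k with inl a => s a | inr b => ~~ t (rev_ord b) end].

Lemma lword_j n (s t : word n) : lword (jword s t) = s.
Proof. by apply/ffunP => k; rewrite !ffunE splitL. Qed.
Lemma rword_j n (s t : word n) : rword (jword s t) = t.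
Proof. by apply/ffunP => k; rewrite !ffunE splitR rev_ordK negbK. Qed.
Lemma jword_lr n (r : word (n + n)) : jword (lword r) (rword r) = r.
Proof.
apply/ffunP => k; rewrite ffunE.
by case: (split_ordP k) => a ->; rewrite ?splitL ?splitR ffunE // rev_ordK negbK.
Qed.

Definition minus_plus_word n : word (n + n) := [ffun k : 'I_(n + n) => n <= k]%N.

Section Phi.
Variables (K : fieldType) (q : K).
Hypothesis q_neq0 : q != 0.

(** The coefficient in [phi_3(v^b)]. *)
Definition sign_wt (b : bool) : K := if b then 1 else - q^-1.
Definition word_wt n (t : word n) : K := \prod_k sign_wt (t k).

Lemma word_wt_neq0 n (t : word n) : word_wt t != 0.
Proof.
apply/prodf_neq0 => k _; rewrite /sign_wt; case: (t k); first exact: oner_neq0.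
by rewrite oppr_eq0 invr_eq0.
Qed.

Lemma Phi_coef n (f : 'End(T K n)) (r : word (n + n)) :
  (Phi q n f r : K) = (f (vword K (rword r)) (lword r) : K) * word_wt (rword r).
Proof.
have pureE (s t : word n) : (pure (fun k : 'I_(n + n) => match fintype.split k with
      | inl i => v_ K (s i) | inr j => phi3 q (t (rev_ord j)) end) r : K) =
    (lword r == s)%:R * ((rword r == t)%:R * word_wt t).
  rewrite ffunE big_split_ord /=; congr (_ * _).
    transitivity (pure (fun k => v_ K (s k)) (lword r) : K); last by rewrite pure_v ffunE.
    by rewrite ffunE; apply: eq_bigr => k _; rewrite splitL ffunE [RHS]ffunE ffunE.
  transitivity ((pure (fun k => v_ K (t k)) (rword r) : K) * word_wt t); last first.
    by rewrite pure_v ffunE.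
  rewrite ffunE /word_wt -big_split /= (reindex_inj rev_ord_inj) /=.
  apply: eq_bigr => k _; rewrite splitR rev_ordK ffunE [rword r k]ffunE.
  by case: (t k); rewrite /phi3 /sign_wt !ffunE; case: (r _); rewrite /= /GRing.scale /=; ring.
rewrite PhiE sum_ffunE (bigD1 (lword r)) //= [X in _ + X]big1 ?addr0.
  rewrite sum_ffunE (bigD1 (rword r)) //= [X in _ + X]big1 ?addr0.
    by rewrite ffunE [LHS]/GRing.scale /= pureE !eqxx !mul1r.
  move=> t /negPf ne; rewrite ffunE [LHS]/GRing.scale /= pureE [rword r == t]eq_sym ne.
  by rewrite mul0r !mulr0.
move=> s /negPf ne; rewrite sum_ffunE big1 // => t _.
by rewrite ffunE [LHS]/GRing.scale /= pureE [lword r == s]eq_sym ne mul0r mulr0.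
Qed.

Lemma Phi_inj n : injective (Phi q n).
Proof.
move=> f g fg; apply: bas_ext => t; apply/ffunP => s.
have := congr1 (fun x : T K (n + n) => x (jword s t) : K) fg.
by rewrite !Phi_coef lword_j rword_j => /(mulIf (word_wt_neq0 t)).
Qed.

Lemma Phi_surj n (x : T K (n + n)) : exists f, Phi q n f = x.
Proof.
exists (lext (fun t : word n =>
  [ffun s => (x (jword s t) : K) / word_wt t] : T K n)).
apply/ffunP => r; rewrite [LHS]Phi_coef lext_bas ffunE jword_lr.
by rewrite divfK // word_wt_neq0.
Qed.

(** An operator [A] on the 2n factors acts on [f] by composition on both sides: its
    left half after [f], and its right half, transposed through phi_3 and taken
    in reverse order, before [f].  The hypothesis says that [B] is this
    transpose. *)
Lemma Phi_tens n (A : 'I_(n + n) -> bool -> C2 K) (B : 'I_n -> bool -> C2 K) f :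
    (forall k b c, sign_wt b * (A (rshift n (rev_ord k)) (~~ b) (~~ c) : K) =
                   sign_wt c * (B k c b : K)) ->
  tens_op A (Phi q n f) =
  Phi q n (tens_op (fun k => A (lshift n k)) \o (f \o tens_op B))%VF.
Proof.
move=> AB; apply/ffunP => r; rewrite [LHS]tens_opE [RHS]Phi_coef.
rewrite ![in RHS]comp_lfunE [X in X * _]tens_opE mulr_suml.
rewrite (reindex (fun st : word n * word n => jword st.1 st.2)) /=; last first.
  exists (fun w => (lword w, rword w)) => [[s t] _|w _] /=; last exact: jword_lr.
  by rewrite lword_j rword_j.
transitivity (\sum_s \sum_t (Phi q n f (jword s t) : K) *
  \prod_k (A k (jword s t k) (r k) : K)); first by rewrite pair_bigA.
apply: eq_bigr => s _.
rewrite [tens_op B _]bas_sum linear_sum sum_ffunE !mulr_suml; apply: eq_bigr => t _.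
rewrite Phi_coef lword_j rword_j linearZ /= !ffunE.
rewrite tens_op_vword ffunE big_split_ord /=.
have -> : \prod_(k < n) (A (lshift n k) (jword s t (lshift n k)) (r (lshift n k)) : K) =
    \prod_(k < n) (A (lshift n k) (s k) (lword r k) : K).
  by apply: eq_bigr => k _; rewrite !ffunE splitL.
set L := \prod_(k < n) (A (lshift n k) (s k) (lword r k) : K).
have right : word_wt t *
    \prod_(k < n) (A (rshift n k) (jword s t (rshift n k)) (r (rshift n k)) : K) =
    word_wt (rword r) * \prod_(k < n) (B k (rword r k) (t k) : K).
  rewrite (reindex_inj rev_ord_inj) /= /word_wt -!big_split /=; apply: eq_bigr => k _.
  by rewrite -AB !ffunE splitR rev_ordK negbK.
rewrite /GRing.scale /= -[bas K t]/(vword K t).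
move: (word_wt t) (word_wt (rword r)) right => c c' right.
transitivity ((f (vword K t) s : K) * L * (c *
  \prod_(k < n) (A (rshift n k) (jword s t (rshift n k)) (r (rshift n k)) : K))).
  by ring.
by rewrite right; ring.
Qed.

Lemma lext_v (V : vectType K) (A : bool -> V) b : lext A (v_ K b) = A b.
Proof. exact: lext_bas. Qed.

Lemma lext_opK (A : bool -> C2 K) b :
  lext A (opK q b) = (if b then q else q^-1) *: A b.
Proof. by rewrite /opK linearZ /= lext_v. Qed.

Lemma lext_opKinv (A : bool -> C2 K) b :
  lext A (opKinv q b) = (if b then q^-1 else q) *: A b.
Proof. by rewrite /opKinv linearZ /= lext_v. Qed.

Lemma UKK n : (Uact q n (UK _) \o Uact q n (UKinv _))%VF = \1%VF.
Proof.
rewrite /= tens_op_comp -tens_op1; congr tens_op; apply/funext => k; apply/funext => b.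
by rewrite lext_opKinv /opK scalerA; case: b; rewrite ?mulVf ?mulfV ?scale1r.
Qed.

Lemma UKVK n : (Uact q n (UKinv _) \o Uact q n (UK _))%VF = \1%VF.
Proof.
rewrite /= tens_op_comp -tens_op1; congr tens_op; apply/funext => k; apply/funext => b.
by rewrite lext_opK /opKinv scalerA; case: b; rewrite ?mulVf ?mulfV ?scale1r.
Qed.

Ltac check_dual := rewrite /sign_wt /opK /opKinv /opE /opF ?ffunE /= /GRing.scale /=; field.

Lemma dual_v b c : sign_wt b * (v_ K (~~ b) (~~ c) : K) = sign_wt c * (v_ K c b : K).
Proof. by case: b; case: c; check_dual. Qed.

Lemma dual_K b c : sign_wt b * (opK q (~~ b) (~~ c) : K) = sign_wt c * (opKinv q c b : K).
Proof. by case: b; case: c; check_dual. Qed.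

Lemma dual_Kinv b c : sign_wt b * (opKinv q (~~ b) (~~ c) : K) = sign_wt c * (opK q c b : K).
Proof. by case: b; case: c; check_dual. Qed.

(** Up to sign, the one-site operators of S(E) and S(F). *)
Definition opKE (b : bool) : C2 K := lext (opK q) (opE K b).
Definition opFKinv (b : bool) : C2 K := lext (opF K) (opKinv q b).

Lemma dual_E b c : sign_wt b * (opE K (~~ b) (~~ c) : K) = sign_wt c * ((- 1 *: opKE c) b : K).
Proof.
by case: b; case: c; rewrite /opKE /= ?linear0 ?lext_v; check_dual.
Qed.

Lemma dual_F b c : sign_wt b * (opF K (~~ b) (~~ c) : K) = sign_wt c * ((- 1 *: opFKinv c) b : K).
Proof.
by case: b; case: c; rewrite /opFKinv lext_opKinv; check_dual.
Qed.

(** The adjoint action [f |-> sum u_1 f S(u_2)] of the generators, for the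
    coproducts of K, its inverse, E and F. *)
Lemma Phi_K n f : Uact q (n + n) (UK _) (Phi q n f) =
  Phi q n (Uact q n (UK _) \o (f \o Uact q n (UKinv _)))%VF.
Proof. by apply: Phi_tens => k; apply: dual_K. Qed.

Lemma Phi_Kinv n f : Uact q (n + n) (UKinv _) (Phi q n f) =
  Phi q n (Uact q n (UKinv _) \o (f \o Uact q n (UK _)))%VF.
Proof. by apply: Phi_tens => k; apply: dual_Kinv. Qed.

Lemma comp_lfun_suml n (I : finType) (A : I -> 'End(T K n)) (f : 'End(T K n)) :
  ((\sum_i A i) \o f)%VF = \sum_i (A i \o f)%VF.
Proof.
by apply/lfunP => x; rewrite comp_lfunE !sum_lfunE; apply: eq_bigr => i _; rewrite comp_lfunE.
Qed.

Lemma comp_lfun_sumr n (I : finType) (A : I -> 'End(T K n)) (f : 'End(T K n)) :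
  (f \o \sum_i A i)%VF = \sum_i (f \o A i)%VF.
Proof.
apply/lfunP => x; rewrite comp_lfunE !sum_lfunE linear_sum.
by apply: eq_bigr => i _; rewrite comp_lfunE.
Qed.

Lemma comp_conj_eq n (a a' b b' f : 'End(T K n)) :
  a = a' -> b = b' -> (a \o (f \o b))%VF = (a' \o (f \o b'))%VF.
Proof. by move=> -> ->. Qed.

(** The summands of E on the left half give E f.  Those on the right half come
    with K^-1 on all left factors; reversal turns the factors K^-1 before E into
    factors K after -KE, and the product is a summand of -KE on n factors. *)
Lemma Phi_E n f : Uact q (n + n) (UE _) (Phi q n f) =
  Phi q n ((Uact q n (UE _) \o f)%VF -
    (Uact q n (UKinv _) \o (f \o (Uact q n (UK _) \o Uact q n (UE _))))%VF).
Proof.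
rewrite [Uact _ _ _]/= sum_lfunE big_split_ord /= raddfB /=; congr (_ + _).
  rewrite comp_lfun_suml linear_sum; apply: eq_bigr => i _.
  rewrite (@Phi_tens _ _ (fun _ => v_ K)) => [|k b c].
    by rewrite tens_op1 comp_lfun1r.
  rewrite -dual_v eq_rlshift /=; case: ifP => //; have := ltn_ord i; lia.
rewrite !comp_lfun_sumr linear_sum -sumrN /=.
rewrite [RHS](reindex_inj rev_ord_inj); apply: eq_bigr => i _ /=.
pose B (k : 'I_n) : bool -> C2 K :=
  if (k < rev_ord i)%N then v_ K
  else if k == rev_ord i then (fun b => - 1 *: opKE b) else opK q.
rewrite (@Phi_tens _ _ B) => [|k b c].
  rewrite -linearN; congr (Phi q n _); rewrite -comp_lfunNr -comp_lfunNr; apply: comp_conj_eq.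
    congr tens_op; apply/funext => k.
    by have -> : (lshift n k < n + i)%N by have := ltn_ord k => /=; lia.
  rewrite tens_op_comp -scaleN1r; apply: (@tens_op_scale _ _ _ _ (rev_ord i)) => k b.
  rewrite /B -[(n - i.+1)%N]/(nat_of_ord (rev_ord i)).
  case: (ltngtP k (rev_ord i)) => h.
  - have -> : (k == rev_ord i) = false by apply/eqP => e; move: h; rewrite e ltnn.
    by rewrite lext_opKinv /opK scalerA; case: b; rewrite ?mulVf ?mulfV ?scale1r.
  - have -> : (k == rev_ord i) = false by apply/eqP => e; move: h; rewrite e ltnn.
    by rewrite lext_v.
  - by rewrite (val_inj h) eqxx.
rewrite /B eq_rshift ltn_add2l -[i in LHS]rev_ordK (inj_eq rev_ord_inj).
have -> : (rev_ord k < rev_ord (rev_ord i))%N = (rev_ord i < k)%N.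
  by have := ltn_ord k; have := ltn_ord i => /=; lia.
rewrite -val_eqE; case: (ltngtP k (rev_ord i)) => h.
- exact: dual_v.
- exact: dual_Kinv.
- exact: dual_E.
Qed.

(** The summands of F on the left half come with K on all right factors, whose
    transpose is K^-1; those on the right half transpose to the summands of
    -FK^-1 on n factors. *)
Lemma Phi_F n f : Uact q (n + n) (UF _) (Phi q n f) =
  Phi q n ((Uact q n (UF _) \o (f \o Uact q n (UKinv _)))%VF -
    (f \o (Uact q n (UF _) \o Uact q n (UKinv _)))%VF).
Proof.
rewrite [Uact _ _ _]/= sum_lfunE big_split_ord /= raddfB /=; congr (_ + _).
  rewrite comp_lfun_suml linear_sum; apply: eq_bigr => i _.
  rewrite (@Phi_tens _ _ (fun _ => opKinv q)) => [|k b c].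
    by [].
  rewrite -dual_K eq_rlshift /=; case: ifP => //; have := ltn_ord i; lia.
rewrite comp_lfun_suml !comp_lfun_sumr linear_sum -sumrN /=.
rewrite [RHS](reindex_inj rev_ord_inj); apply: eq_bigr => i _ /=.
pose B (k : 'I_n) : bool -> C2 K :=
  if (k < rev_ord i)%N then opKinv q
  else if k == rev_ord i then (fun b => - 1 *: opFKinv b) else v_ K.
rewrite (@Phi_tens _ _ B) => [|k b c].
  rewrite -linearN; congr (Phi q n _); rewrite -comp_lfunNr.
  have -> : tens_op (fun k => if (lshift n k < n + i)%N then v_ K
      else if lshift n k == rshift n i then opF K else opK q) = \1%VF.
    rewrite -tens_op1; congr tens_op; apply/funext => k.
    by have -> : (lshift n k < n + i)%N by have := ltn_ord k => /=; lia.
  rewrite -[in RHS](comp_lfun1l f) -[in RHS]comp_lfunA; apply: comp_conj_eq => //.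
  rewrite tens_op_comp -scaleN1r; apply: (@tens_op_scale _ _ _ _ (rev_ord i)) => k b.
  rewrite /B -[(n - i.+1)%N]/(nat_of_ord (rev_ord i)).
  case: (ltngtP k (rev_ord i)) => h.
  - have -> : (k == rev_ord i) = false by apply/eqP => e; move: h; rewrite e ltnn.
    by rewrite lext_opKinv /opKinv; case: b.
  - have -> : (k == rev_ord i) = false by apply/eqP => e; move: h; rewrite e ltnn.
    by rewrite lext_opKinv /opK scalerA; case: b; rewrite ?mulVf ?mulfV ?scale1r.
  - by rewrite (val_inj h) eqxx.
rewrite /B eq_rshift ltn_add2l -[i in LHS]rev_ordK (inj_eq rev_ord_inj).
have -> : (rev_ord k < rev_ord (rev_ord i))%N = (rev_ord i < k)%N.
  by have := ltn_ord k; have := ltn_ord i => /=; lia.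
rewrite -val_eqE; case: (ltngtP k (rev_ord i)) => h.
- exact: dual_K.
- exact: dual_v.
- exact: dual_F.
Qed.

(** For an intertwiner the adjoint action is through the counit, as K, E and F
    can be moved across [f] and cancel. *)
Lemma EndU_invU n f : EndU q f -> invU q (Phi q n f).
Proof.
move=> fU; have VK := UKVK n; have KV := UKK n.
elim=> [||||a|u IHu v IHv|u IHu v IHv].
- rewrite Phi_E (comp_lfunA f) -(fU (UK _)) -comp_lfunA (comp_lfunA (Uact q n (UKinv _))).
  by rewrite VK comp_lfun1l fU subrr linear0 scale0r.
- by rewrite Phi_F (comp_lfunA f) -(fU (UF _)) -comp_lfunA subrr linear0 scale0r.
- by rewrite Phi_K -fU comp_lfunA KV comp_lfun1l scale1r.
- by rewrite Phi_Kinv -fU comp_lfunA VK comp_lfun1l scale1r.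
- by rewrite /= scale_lfunE id_lfunE.
- by rewrite /= add_lfunE IHu IHv scalerDl.
- by rewrite [Uact _ _ _]/= comp_lfunE IHv linearZ /= IHu scalerA mulrC.
Qed.

(** Conversely, invariance under K gives commutation with K, and with it the
    vanishing of the adjoint actions of E and F gives commutation with them. *)
Lemma invU_EndU n f : invU q (Phi q n f) -> EndU q f.
Proof.
move=> inv; have VK := UKVK n; have KV := UKK n.
have hK : (Uact q n (UK _) \o (f \o Uact q n (UKinv _)))%VF = f.
  by apply: (@Phi_inj n); rewrite -Phi_K inv scale1r.
have hV : (Uact q n (UKinv _) \o (f \o Uact q n (UK _)))%VF = f.
  by apply: (@Phi_inj n); rewrite -Phi_Kinv inv scale1r.
elim=> [||||a|u IHu v IHv|u IHu v IHv].
- have /eqP := inv (UE _); rewrite Phi_E scale0r -(linear0 (Phi q n)) (inj_eq (@Phi_inj n)).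
  by rewrite subr_eq0 (comp_lfunA f) (comp_lfunA (Uact q n (UKinv _))) hV => /eqP.
- have /eqP := inv (UF _); rewrite Phi_F scale0r -(linear0 (Phi q n)) (inj_eq (@Phi_inj n)).
  rewrite subr_eq0 => /eqP /(congr1 (fun g => g \o Uact q n (UK _))%VF).
  by rewrite -!comp_lfunA VK !comp_lfun1r.
- by rewrite -{1}hV comp_lfunA KV comp_lfun1l.
- by rewrite -{1}hK comp_lfunA VK comp_lfun1l.
- by rewrite /= -comp_lfunZl -comp_lfunZr comp_lfun1l comp_lfun1r.
- by rewrite /= comp_lfunDl comp_lfunDr IHu IHv.
- by rewrite [Uact _ _ _]/= -comp_lfunA IHv !comp_lfunA IHu.
Qed.

Lemma Phi_bij n : set_bij (EndU q (m := n)) (invU q (m := n + n)) (Phi q n).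
Proof.
split.
- by move=> f; apply: EndU_invU.
- by move=> f g _ _; apply: Phi_inj.
- move=> x inv; have [f fx] := Phi_surj x; exists f => //.
  by apply: invU_EndU; rewrite fx.
Qed.

Lemma v_minus_plus_vword n : v_minus_plus K n = vword K (minus_plus_word n).
Proof. by rewrite -pure_v; congr pure; apply/funext => k; rewrite ffunE. Qed.

(** Applied to v_-...- v_+...+ all caps of [D_B] take the value epsilon(v_-, v_+) =
    1, so only the nested cups remain, whose coefficients are those of Phi(id);
    then [D |_| 1_n] acts on the left half only. *)
Lemma Phi_diagram_op n (D : diagram n) :
  Phi q n (diagram_op q D) =
  diagram_op q (add_id D) (diagram_op q (DB n) (v_minus_plus K n)).
Proof.
rewrite v_minus_plus_vword; set w0 := minus_plus_word n.
(* The nested cups force the word to be symmetric up to complement. *)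
have DBE (w : word (n + n)) :
    diagram_coef q (DB n) w w0 = (lword w == rword w)%:R * word_wt (rword w).
  rewrite /diagram_coef big_sumType /= big1 => [|k _]; last first.
    rewrite /mate /= ffunE /= !ffunE /=; case: ifP => // kr.
    have -> : (n <= k)%N = false by have := ltn_ord k; lia.
    by have -> : (n <= n + n - k.+1)%N by lia.
  rewrite mul1r big_split_ord /= [X in _ * X]big1 ?mulr1 => [|k _]; last first.
    rewrite /mate /= ffunE /=; case: ifP => //; have := ltn_ord k; lia.
  rewrite -word_eq_prod /word_wt -big_split /=; apply: eq_bigr => k _.
  rewrite /mate /= ffunE /=; have -> : (k < n + n - k.+1)%N by have := ltn_ord k; lia.
  have -> : rev_ord (lshift n k) = rshift n (rev_ord k).
    by apply: val_inj => /=; have := ltn_ord k; lia.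
  rewrite !ffunE; case: (w (lshift n k)); case: (w _);
    by rewrite /= ?mul0r ?mul1r.
(* The through links on the right preserve the right half of the word. *)
have addE (s w : word (n + n)) : diagram_coef q (add_id D) s w =
    (rword w == rword s)%:R * diagram_coef q D (lword s) (lword w).
  have mE p : add_id D p = add_id_link D p by rewrite /mate ffunE.
  have leftE (p r : vertex n) : link_weight q s w (left_vertex p) (left_vertex r) =
      link_weight q (lword s) (lword w) p r.
    by case: p => k; case: r => l; rewrite /= ?ffunE.
  rewrite /diagram_coef !big_sumType /= !big_split_ord /=.
  rewrite [X in _ * (_ * X)]big1 ?mulr1 => [|k _]; last by rewrite mE /= splitR.
  rewrite mulrA [(_ == _)%:R * _]mulrC -mulrA [in RHS]mulrAC -mulrA.
  congr (_ * _).
    by apply: eq_bigr => k _; rewrite mE /= splitL; exact: (leftE (inl k)).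
  rewrite mulrC; congr (_ * _).
    by apply: eq_bigr => k _; rewrite mE /= splitL; exact: (leftE (inr k)).
  rewrite -word_eq_prod (reindex_inj rev_ord_inj) /=; apply: eq_bigr => k _.
  by rewrite mE /= splitR !ffunE (inj_eq negb_inj).
apply/ffunP => r; rewrite [LHS]Phi_coef !lext_bas ffunE.
rewrite /diagram_op lextE sum_ffunE (bigD1 (jword (rword r) (rword r))) //= big1 ?addr0.
  rewrite !ffunE DBE addE lword_j rword_j !eqxx !mul1r [RHS]/GRing.scale /=.
  exact: mulrC.
move=> w ne; rewrite !ffunE DBE addE [LHS]/GRing.scale /=.
have [lr|] := eqVneq (lword w) (rword w); last by rewrite !mul0r.
have [rr|] := eqVneq (rword w) (rword r); last by rewrite mul0r mulr0.
by move: ne; rewrite -rr -{1}lr jword_lr eqxx.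
Qed.

End Phi.

(** * The action on diagrams and the induced module *)

Section Action.
Variables (K : fieldType) (q : K).
Hypothesis q_neq0 : q != 0.

Lemma TL_mul_dg m (A B : diagram m) : TL_mul q (dg K A) (dg K B) = stack q A B.
Proof. by rewrite /TL_mul !lext_bas. Qed.

(** An action of TL_m is determined on diagrams by its values on the generators,
    and agrees with the link formula there. *)
Lemma TL_action_dg m (rho : 'Hom(TL K m, 'End(T K m))) (D : diagram m) :
  TL_action q rho -> rho (dg K D) = diagram_op q D.
Proof.
move=> [rho1 rhoM rhoe]; elim/diagram_ind_exchange: D => [|i x D D0 ex IH].
  by rewrite diagram_op_id -rho1.
by rewrite -(exchange_stack q ex) -TL_mul_dg rhoM rhoe IH (exchange_op q_neq0 ex).
Qed.

Lemma diagram_op_EndU m (D : diagram m) : EndU q (diagram_op q D).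
Proof.
elim/diagram_ind_exchange: D => [|i x D D0 ex IH] u.
  by rewrite diagram_op_id comp_lfun1l comp_lfun1r.
by rewrite -(exchange_op q_neq0 ex) comp_lfunA e_op_Uact // -!comp_lfunA IH.
Qed.

(** Away from the middle, neighbouring letters are equal and epsilon vanishes. *)
Lemma e_op_v_minus_plus n (i : 'I_(n + n).-1) :
  i.+1 != n -> e_op q i (v_minus_plus K n) = 0.
Proof.
move=> ne; rewrite v_minus_plus_vword e_op_vword !ffunE /=.
have -> : (n <= i.+1)%N = (n <= i)%N by lia.
by case: (n <= i)%N; rewrite scale0r.
Qed.

Section Induced.
Variables (n : nat) (rho : 'Hom(TL K (n + n), 'End(T K (n + n)))).
Hypothesis rho_action : TL_action q rho.

Lemma triv_acts_v_minus_plus s c :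
  triv_acts q s c -> rho s (v_minus_plus K n) = c *: v_minus_plus K n.
Proof.
have [rho1 rhoM rhoe] := rho_action.
elim=> [i ne||a t d _ IH|t u d e _ IHt _ IHu|t u d e _ IHt _ IHu].
- by rewrite rhoe e_op_v_minus_plus // scale0r.
- by rewrite rho1 id_lfunE scale1r.
- by rewrite linearZ /= scale_lfunE IH scalerA.
- by rewrite linearD /= add_lfunE IHt IHu scalerDl.
- by rewrite rhoM comp_lfunE IHu linearZ /= IHt scalerA mulrC.
Qed.

Lemma ind_rel_v_minus_plus x : ind_rel q x -> rho x (v_minus_plus K n) = 0.
Proof.
have [_ rhoM _] := rho_action.
elim=> [y s c sc||a y z _ IHy _ IHz].
- rewrite linearB /= add_lfunE opp_lfunE rhoM comp_lfunE (triv_acts_v_minus_plus sc).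
  by rewrite linearZ /= linearZ /= scale_lfunE subrr.
- by rewrite linear0 zero_lfunE.
- by rewrite linearD linearZ /= add_lfunE scale_lfunE IHy IHz scaler0 addr0.
Qed.

Lemma rho_prime_of (D : diagram n) :
  rho (prime_of q D) (v_minus_plus K n) = Phi q n (diagram_op q D).
Proof.
have [_ rhoM _] := rho_action.
by rewrite /prime_of rhoM comp_lfunE !(TL_action_dg _ rho_action) -Phi_diagram_op.
Qed.

Lemma ind_embE (z : TL K n) :
  ind_emb q z = ind_class q (\sum_D (z D : K) *: prime_of q D).
Proof.
have sumE : {morph @ind_class K q n : x y / x + y} by move=> x y; apply: ind_classD.
rewrite (big_morph _ sumE (raddf0 _)); apply: eq_bigr => D _.
by rewrite ind_class_scale.
Qed.

(** If an element is sent to 0 in the induced module, acting on v_-...- v_+...+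
    shows that Phi kills its operator; Phi is injective and the operators of the
    diagrams are independent. *)
Lemma ind_emb_inj : injective (@ind_emb K q n).
Proof.
move=> x y xy; apply/eqP; rewrite -subr_eq0; apply/eqP.
apply: (diagram_op_free q_neq0); apply: (@Phi_inj _ _ q_neq0 n).
have /ind_class_eq/ind_rel_v_minus_plus : ind_class q
    (\sum_D ((x - y) D : K) *: prime_of q D) = ind_class q 0.
  by rewrite -ind_embE linearB /= xy subrr /ind_class raddf0.
rewrite subr0 !linear_sum linear0 sum_lfunE => {2}<-; apply: eq_bigr => D _.
by rewrite !linearZ /= scale_lfunE rho_prime_of.
Qed.
End Induced.
End Action.

Unset Implicit Arguments.

Theorem theorem9p9 (R : realType) (q : R[i])
    (q_neq0 : q != 0)
    (q_not_root_of_unity : forall k : nat, (0 < k)%N -> q ^+ k != 1)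
    (rho : forall m : nat, 'Hom(TL R[i] m, 'End(T R[i] m)))
    (rho_action : forall m : nat, TL_action q (rho m))
    (n : nat) (n_ge1 : (1 <= n)%N) :
  injective (@ind_emb _ q n : TL R[i] n -> Ind q n) /\
  set_bij (EndU q (m := n)) (invU q (m := n + n)) (Phi q n) /\
  (forall D : diagram n,
     EndU q (rho n (dg R[i] D)) /\
     Phi q n (rho n (dg R[i] D)) =
       rho (n + n)%N (prime_of q D) (v_minus_plus R[i] n)).
Proof.
split; first exact: ind_emb_inj (rho_action _).
split=> [|D]; first exact: Phi_bij.
rewrite (TL_action_dg q_neq0 _ (rho_action n)); split; first exact: diagram_op_EndU.
by rewrite (rho_prime_of q_neq0 (rho_action _)).
Qed.
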